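(* Let $n$ be a positive integer. Define two sequences of partitions indexed by the intervals $I$ between consecutive elements of the Farey sequence $F_n$, both starting from the one-row partition: $\lambda_{[0,1/n]}=\widetilde{\lambda}_{[0,1/n]}=(n)$, and whenever $I=[x,\tfrac ab]$, $I'=[\tfrac ab,y]$ are consecutive intervals with $\tfrac ab$ reduced, $\lambda_{I'}=(\lambda_I)^{\mathcal W_b}$ and $\widetilde{\lambda}_{I'}=(\widetilde\lambda_I)^{\mathrm{Cr}_{a,b}}$ (the latter is a partition of $n$ at every step). Let $0=p_0<p_1<\dots<p_s$ consist of $0$ and the walls $w\in F_n$, $0<w<1$, at which the partitions $\lambda_I$ on the two intervals adjacent to $w$ differ; for $1\le k\le s+1$ let $\lambda_k$ be the partition $\lambda_I$ for the intervals $I\subseteq[p_{k-1},p_k]$ (with $p_{s+1}=1$). Similarly let $0=q_0<q_1<\dots<q_t$ be the corresponding breaks for the sequence $\widetilde\lambda_I$ and $\widetilde{\lambda_k}$ the partition on $[q_{k-1},q_k]$ (with $q_{t+1}=1$). Then: (1) $s=t$, and for every $1\le k\le s$, $$p_k=q_k=\min_{(i,j)\in\lambda_k}\frac{l_{ij}+1}{H_{ij}}=\max_{(i,j)\in\lambda_{k+1}}\frac{l_{ij}}{H_{ij}};$$ (2) $\lambda_k=\widetilde{\lambda_k}$ for all $k$.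
   Context: Partitions are identified with Young diagrams: box $(i,j)$ with row index $i\ge1$ (the $x$-coordinate, increasing southwards) and column index $1\le j\le\lambda_i$ (the $y$-coordinate, increasing eastwards). Arm $a_{ij}=\lambda_i-j$, leg $l_{ij}=\lambda^{\mathrm{Tr}}_j-i$, hook $H_{ij}=a_{ij}+l_{ij}+1$. The residue of $(i,j)$ w.r.t. $b$ is $(j-i)\bmod b$. $\lambda$ is $b$-regular if no $b$ nonzero parts are equal. The Farey sequence $F_n$ is the increasing list of reduced fractions in $[0,1]$ (including $0,1$) with denominator $\le n$; its interior elements are called walls. Good/co-good boxes: a box $A\in\lambda$ is removable if $\lambda\setminus A$ is a partition, $B\notin\lambda$ addable if $\lambda\cup B$ is a partition. For a residue $r$, list the removable (''R'') and addable (''A'') boxes of residue $r$ in increasing order of content $j-i$. Deleting iteratively adjacent pairs ''RA'', the box of the leftmost remaining R (if any) is the good box of residue $r$; deleting iteratively adjacent pairs ''AR'', the box of the rightmost remaining R (if any) is the co-good box of residue $r$. Mullineux transpose: for a $b$-regular partition $\lambda$ of $m$, remove successively good boxes $A_1,\dots,A_m$ (with $A_i$ good in $\lambda\setminus(A_1\cup\dots\cup A_{i-1})$), recording residues $r_1,\dots,r_m$. Then set $\mu_m=\emptyset$ and for $i=m,m-1,\dots,1$ let $\mu_{i-1}=\mu_i\cup B_i$ where $B_i$ is the unique box such that $B_i$ is a co-good box of residue $r_i$ of $\mu_i\cup B_i$. Then $\lambda^{M_bT}:=\mu_0$, and the Mullineux map is $\lambda^{M_b}:=(\lambda^{M_bT})^{\mathrm{Tr}}$.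 Extended Mullineux transpose $\mathcal W_b$: every partition $\lambda$ decomposes uniquely as a multiset union $\lambda=\nu\cup b\star\mu$ where every part of $\nu$ has multiplicity $<b$ and $b\star\mu$ repeats each part of $\mu$ exactly $b$ times; define $\lambda^{\mathcal W_b}=(\nu^{M_b}\cup b\star\mu^{\mathrm{Tr}})^{\mathrm{Tr}}$. Generalized column regularization: for coprime $0<a<b$ and $c\in\mathbb Z$, the ladder $L_c$ is the line $y+\frac{b-a}{a}x=\frac ca$; $L_c^+$ is the set of integer points on it with $x,y>0$. $\lambda^{\mathrm{Cr}_{a,b}}$ is obtained by replacing, for each $c$, the boxes of $\lambda\cap L_c^+$ by the same number of points of $L_c^+$ with largest $x$-coordinate. *)

(* Defs.v *)
From mathcomp Require Import all_boot all_order all_algebra finmap.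

Set Implicit Arguments.
Unset Strict Implicit.
Unset Printing Implicit Defensive.

Import Order.TTheory GRing.Theory Num.Theory.

Local Open Scope nat_scope.

(** * Partitions and Young diagrams *)

(* The box (i, j) is in row i and column j, both numbered from 1; row i of la
   has length nth 0 la i.-1. *)
Definition box := (nat * nat)%type.

Definition is_partition (la : seq nat) : bool :=
  sorted geq la && (0 \notin la).

Definition boxes (la : seq nat) : seq box :=
  [seq (i, j) | i <- iota 1 (size la), j <- iota 1 (nth 0 la i.-1)].

Definition diagram (la : seq nat) : {fset box} := [fset B in boxes la]%fset.

Definition conj_part (la : seq nat) : seq nat :=
  mkseq (fun j => count (fun x => j < x) la) (head 0 la).

Definition arm (la : seq nat) (B : box) : nat := nth 0 la B.1.-1 - B.2.
Definition leg (la : seq nat) (B : box) : nat :=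
  nth 0 (conj_part la) B.2.-1 - B.1.
Definition hook (la : seq nat) (B : box) : nat := arm la B + leg la B + 1.

Definition content (B : box) : int := (B.2%:Z - B.1%:Z)%R.
Definition residue (b : nat) (B : box) : int := (content B %% b%:Z)%Z.

(** * Good and co-good boxes *)

(* [add_box] and [del_box] are meant for B at the end of its row. The zero that
   [del_box] filters out is the last row of la when that row is a single box. *)
Definition add_box (la : seq nat) (B : box) : seq nat :=
  set_nth 0 la B.1.-1 B.2.
Definition del_box (la : seq nat) (B : box) : seq nat :=
  [seq x <- set_nth 0 la B.1.-1 B.2.-1 | 0 < x].

Definition removable (la : seq nat) (B : box) : bool :=
  [&& B \in boxes la, B.2 == nth 0 la B.1.-1
    & sorted geq (set_nth 0 la B.1.-1 B.2.-1)].

Definition addable (la : seq nat) (B : box) : bool :=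
  [&& 0 < B.1, B.2 == (nth 0 la B.1.-1).+1 & is_partition (add_box la B)].

(* A letter (true, B) is an "R" (removable box B), and (false, B) an "A"
   (addable box B). The grid contains all removable and addable boxes of la. *)
Definition letter := (bool * box)%type.

Definition signature (b : nat) (r : int) (la : seq nat) : seq letter :=
  let grid := [seq (i, j) | i <- iota 1 (size la).+1,
                            j <- iota 1 (head 0 la).+1] in
  let word := [seq (true, B) | B <- grid & removable la B] ++
              [seq (false, B) | B <- grid & addable la B] in
  sort (fun t u : letter => (content t.2 <= content u.2)%R)
       [seq t <- word | residue b t.2 == r].

(* What is left of w after iterated deletion of the adjacent pairs whose first
   letter has kind k and whose second letter has the other kind; computed in
   one pass from left to right with a stack. *)
Definition cancel_push (k : bool) (st : seq letter) (t : letter) : seq letter :=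
  if st is u :: st' then
    if (u.1 == k) && (t.1 == ~~ k) then st' else t :: st
  else [:: t].
Definition cancel_pairs (k : bool) (w : seq letter) : seq letter :=
  rev (foldl (cancel_push k) [::] w).

Definition remaining_R (k : bool) (b : nat) (r : int) (la : seq nat) :
    seq box :=
  [seq t.2 | t <- cancel_pairs k (signature b r la) & t.1].

Definition is_good_box (b : nat) (r : int) (la : seq nat) (B : box) : Prop :=
  ohead (remaining_R true b r la) = Some B.
Definition is_cogood_box (b : nat) (r : int) (la : seq nat) (B : box) : Prop :=
  ohead (rev (remaining_R false b r la)) = Some B.

(** * The Mullineux transpose and its extension *)

Definition b_regular (b : nat) (la : seq nat) : bool :=
  all (fun x => count_mem x la < b) la.

(* [mullineux_tr b la mu]: some run of the procedure leads from la to mu. The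
   good box A removed first is matched with the co-good box B added last, so
   a run on la is a run on la minus A, followed by the addition of B. *)
Inductive mullineux_tr (b : nat) : seq nat -> seq nat -> Prop :=
| MullineuxNil : mullineux_tr b [::] [::]
| MullineuxStep (r : int) (la mu : seq nat) (A B : box) :
    is_good_box b r la A ->
    mullineux_tr b (del_box la A) mu ->
    addable mu B ->
    is_cogood_box b r (add_box mu B) B ->
    mullineux_tr b la (add_box mu B).

Definition part_union (la mu : seq nat) : seq nat := sort geq (la ++ mu).
Definition part_star (b : nat) (mu : seq nat) : seq nat :=
  flatten [seq nseq b x | x <- mu].

(* [ext_mullineux_tr b la mu]: mu is obtained from la by the extended Mullineux
   transpose. Here nuT is the Mullineux transpose of nu, so that conj_part nuT
   is the image of nu under the Mullineux map. *)
Definition ext_mullineux_tr (b : nat) (la mu : seq nat) : Prop :=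
  exists nu ka nuT : seq nat,
    [/\ [&& is_partition nu, is_partition ka & b_regular b nu],
        la = part_union nu (part_star b ka),
        mullineux_tr b nu nuT
      & mu = conj_part (part_union (conj_part nuT)
                                   (part_star b (conj_part ka)))].

(** * Generalized column regularization *)

(* For 0 < a < b the ladder y + (b-a)/a x = c/a has equation
   a y + (b - a) x = c. *)
Definition ladder_index (a b : nat) (P : box) : nat :=
  a * P.2 + (b - a) * P.1.

(* The points of the ladder with positive coordinates (which are at most c),
   by decreasing x-coordinate. *)
Definition ladder (a b c : nat) : seq box :=
  [seq P <- [seq (x, y) | x <- rev (iota 1 c), y <- iota 1 c]
     | ladder_index a b P == c].

(* Acts on sets of boxes: that the result is a Young diagram is not built in. *)
Definition column_reg (a b : nat) (D : {fset box}) : {fset box} :=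
  let moved c := take (count (mem D) (ladder a b c)) (ladder a b c) in
  [fset P in flatten [seq moved c | c <- [seq ladder_index a b P | P <- D]]]%fset.

(** * Farey sequence and wall-crossing *)

Definition farey (n : nat) : seq rat :=
  sort (fun x y : rat => (x <= y)%R)
       [seq (p%:R / q%:R)%R | q <- iota 1 n,
                              p <- [seq p <- iota 0 q.+1 | coprime p q]].

(* Families indexed by the intervals of the Farey sequence are functions on
   nat, with i standing for the interval between the entries i and i.+1 of
   farey n; only the values at i < (size (farey n)).-1 are relevant. The
   intervals i and i.+1 are separated by the wall w = entry i.+1. *)
Definition mullineux_seq (n : nat) (lam : nat -> seq nat) : Prop :=
  lam 0 = [:: n] /\
  forall i, i.+2 < size (farey n) ->
    let w := nth 0%R (farey n) i.+1 in
    ext_mullineux_tr `|denq w| (lam i) (lam i.+1).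

Definition column_reg_seq (n : nat) (lam : nat -> {fset box}) : Prop :=
  lam 0 = diagram [:: n] /\
  forall i, i.+2 < size (farey n) ->
    let w := nth 0%R (farey n) i.+1 in
    lam i.+1 = column_reg `|numq w| `|denq w| (lam i).

(* The list p_0 = 0, p_1, ..., p_s. *)
Definition breaks (T : eqType) (n : nat) (f : nat -> T) : seq rat :=
  0%R :: [seq nth 0%R (farey n) i.+1 | i <- iota 0 (size (farey n)).-2
                                     & f i != f i.+1].

(* For 1 <= k <= s+1, the value of f on the interval with left endpoint
   p_(k-1), hence on all intervals contained in [p_(k-1), p_k]: see
   [pieceE], where the default value 1 of nth provides p_(s+1) = 1. *)
Definition piece (T : eqType) (n : nat) (f : nat -> T) (k : nat) : T :=
  f (index (nth 0%R (breaks n f) k.-1) (farey n)).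

Lemma farey_sorted (n : nat) : sorted (fun x y : rat => (x < y)%R) (farey n).
Proof.
rewrite lt_sorted_uniq_le sort_le_sorted andbT sort_uniq.
apply: allpairs_uniq_dep; first exact: iota_uniq.
  by move=> q _; rewrite filter_uniq // iota_uniq.
case=> q p [q' p'] /allpairsPdep[x [y []]] xn + [-> ->].
rewrite mem_filter => /andP[cxy _].
case/allpairsPdep=> [x' [y' []]] xn' + [-> ->].
rewrite mem_filter => /andP[cxy' _] /= E.
have x0 : (0 < x)%N by move: xn; rewrite mem_iota => /andP[].
have x0' : (0 < x')%N by move: xn'; rewrite mem_iota => /andP[].
have den (u v : nat) : 0 < v -> coprime u v ->
    denq (u%:R / v%:R)%R = Posz v /\ numq (u%:R / v%:R)%R = Posz u.
  move=> v0 cuv.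
  have v0' : Posz v != 0%R by rewrite eqz_nat -lt0n.
  have := @coprimeq_num (Posz u) (Posz v) cuv.
  have := @coprimeq_den (Posz u) (Posz v) cuv.
  by rewrite (negPf v0') gtr0_sg // mul1r gtr0_norm.
have [d1 n1] := den _ _ x0 cxy; have [d2 n2] := den _ _ x0' cxy'.
move: d1 n1; rewrite E d2 n2 => -[->] -[->] //.
Qed.

Lemma farey_nth0 (n : nat) : 0 < n -> nth 0%R (farey n) 0 = 0%R.
Proof.
move=> n0.
have f0 : (0%R : rat) \in farey n.
  rewrite mem_sort; apply/allpairsPdep; exists 1, 0; split=> //.
  by rewrite mem_iota /=; case: n n0.
have ge0 : (0 <= nth 0%R (farey n) 0)%R.
  have [/(mem_nth 0%R)|/(nth_default 0%R)->//] := ltnP 0 (size (farey n)).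
  rewrite mem_sort => /allpairsPdep[q [p [_ _ ->]]].
  by rewrite divr_ge0 ?ler0n.
apply/eqP; rewrite eq_le ge0 andbT.
have := f0; rewrite -index_mem => lt0.
rewrite -[leRHS](nth_index 0%R f0).
rewrite (lt_sorted_leq_nth 0%R (farey_sorted n)) //.
by rewrite unfold_in; apply: leq_ltn_trans lt0.
Qed.

Lemma breaks_sorted (T : eqType) (n : nat) (f : nat -> T) : 0 < n ->
  sorted (fun x y : rat => (x < y)%R) (breaks n f).
Proof.
move=> n0.
pose J := 0 :: map S [seq i <- iota 0 (size (farey n)).-2 | f i != f i.+1].
have -> : breaks n f = map (nth 0%R (farey n)) J.
  by rewrite /breaks /J /= farey_nth0 // -map_comp.
have sJ : sorted ltn J.
  rewrite /J /= path_min_sorted; last by apply/allP=> x /mapP[y _ ->].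
  rewrite sorted_map; apply: sorted_filter; last exact: iota_ltn_sorted.
  by move=> y x z; apply: ltn_trans.
have JF : all (fun j => (j == 0) || (j < size (farey n))) J.
  apply/allP=> j; rewrite inE => /orP[->//|/mapP[i]].
  rewrite mem_filter mem_iota add0n => /andP[_ /andP[_ iF]] ->.
  by apply/orP; right; rewrite -ltn_predRL (leq_trans iF) // leq_pred.
have F0 : 0 < size (farey n).
  rewrite size_sort lt0n size_eq0; apply/eqP => E.
  suff : (0%R : rat) \in [::] by [].
  rewrite -E; apply/allpairsPdep; exists 1, 0; split=> //.
  by rewrite mem_iota /=; case: n n0 {E J sJ JF}.
rewrite sorted_map.
apply: (sub_in_sorted (P := fun j => j < size (farey n))) _ sJ.
  move=> x y; rewrite !unfold_in => xF yF xy /=.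
  by rewrite (lt_sorted_ltn_nth 0%R (farey_sorted n)).
by apply: sub_all JF => j /orP[/eqP->|].
Qed.

(* i ranges over the intervals contained in [p_(k-1), p_k]. *)
Lemma pieceE (T : eqType) (n : nat) (f : nat -> T) (k i : nat) :
  0 < n -> 0 < k <= size (breaks n f) -> i.+1 < size (farey n) ->
  (nth 1%R (breaks n f) k.-1 <= nth 0%R (farey n) i)%R ->
  (nth 0%R (farey n) i.+1 <= nth 1%R (breaks n f) k)%R ->
  f i = piece n f k.
Proof.
case: k => // k n0 /andP[_ kb] iF; rewrite /piece [k.+1.-1]/=.
have sF := farey_sorted n; have sB := breaks_sorted f n0.
have leF u v : u < size (farey n) -> v < size (farey n) ->
    (nth 0%R (farey n) u <= nth 0%R (farey n) v)%R = (u <= v).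
  by move=> uF vF; apply: (lt_sorted_leq_nth 0%R sF).
rewrite [X in (X <= _)%R](set_nth_default 0%R) // => lo hi.
set j := index _ _.
have bF : nth 0%R (breaks n f) k \in farey n.
  have := mem_nth 0%R kb; rewrite inE => /orP[/eqP->|].
    by rewrite -(farey_nth0 n0) mem_nth // (leq_ltn_trans _ iF).
  case/mapP=> u; rewrite mem_filter mem_iota add0n => /andP[_ /andP[_ uF]] ->.
  by rewrite mem_nth // -ltn_predRL (leq_trans uF) // leq_pred.
have jF : j < size (farey n) by rewrite index_mem.
have jE : nth 0%R (farey n) j = nth 0%R (breaks n f) k by apply: nth_index.
have ji : j <= i by rewrite -leF // ?jE // ltnW.
have step m : j <= m < i -> f m = f m.+1.
  case/andP=> jm mi; apply/eqP/negPn/negP=> ne.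
  have mF : m.+1 < size (farey n) by apply: leq_ltn_trans iF; apply: ltnW.
  have mB : nth 0%R (farey n) m.+1 \in breaks n f.
    rewrite inE; apply/orP; right; apply: map_f.
    rewrite mem_filter ne mem_iota add0n /=.
    rewrite -subn2 ltn_subRL; apply: leq_ltn_trans iF.
    by rewrite add2n ltnS.
  have tB := mB; rewrite -index_mem in tB.
  set t := index _ _ in tB.
  have tE : nth 0%R (breaks n f) t = nth 0%R (farey n) m.+1.
    exact: nth_index.
  have kt : k < t.
    rewrite -(lt_sorted_ltn_nth 0%R sB) ?unfold_in // tE -jE.
    by rewrite (lt_sorted_ltn_nth 0%R sF) ?unfold_in // ltnS.
  have kb' : k.+1 < size (breaks n f) by apply: leq_ltn_trans tB.
  move: hi; rewrite (set_nth_default 0%R) // => hi.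
  have : (nth 0%R (breaks n f) k.+1 <= nth 0%R (breaks n f) t)%R.
    by rewrite (lt_sorted_leq_nth 0%R sB) ?unfold_in.
  move/(le_trans hi); rewrite tE leF //.
  by rewrite ltnS leqNgt mi.
move: step; rewrite -(subnK ji) addnC; elim: (i - j) => [|d IH] st.
  by rewrite addn0.
rewrite addnS -st ?addnS ?leq_addr ?ltnSn //; apply: IH => m /andP[a b].
by apply: st; rewrite a addnS ltnW.
Qed.

Definition is_min (m : rat) (s : seq rat) : Prop :=
  m \in s /\ forall x, x \in s -> (m <= x)%R.
Definition is_max (m : rat) (s : seq rat) : Prop :=
  m \in s /\ forall x, x \in s -> (x <= m)%R.

Definition leg_ratios (la : seq nat) : seq rat :=
  [seq ((leg la B)%:R / (hook la B)%:R)%R | B <- boxes la].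
Definition leg1_ratios (la : seq nat) : seq rat :=
  [seq ((leg la B).+1%:R / (hook la B)%:R)%R | B <- boxes la].

(* Main.v *)
(* For a slope t strictly between two consecutive walls, the partition is the set
   of the n boxes (x, y) with the smallest values of x + t (y - x). At a wall a/b
   the boxes of a ladder become tied, and on crossing it the boxes of the only
   partially filled ladder slide from its top end to its bottom end: this is
   Cr_{a,b}, and the extremal hook ratios are read off that ladder. The next wall
   where a tie occurs is an entry of the Farey sequence because the tied boxes
   span a hook, whose length is at most n.

   To compare with the Mullineux transpose, note that the points of a ladder have
   equal residues. For the partitions that are filled from the top on every
   ladder and whose hooks of length H divisible by b have b (leg + 1) <= a H, the
   letters A and R of a residue come ladder by ladder. Since the number of A's on
   a ladder minus the number of R's on the previous ladder of that residue is
   determined by the numbers of boxes on the ladders, a partition of this kind and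
   one of the mirror kind (filled from the bottom) with equal ladder counts have
   mirror reduced words; so the good box of the former and the co-good box of the
   latter lie on the same ladder, and removing both preserves the situation.
   Hence every run of the Mullineux procedure keeps the ladder counts. *)

(* Triangular diagrams are not stable under the runs: for [a/b = 2/5] the box (2,1) of the partition
   (3,1) is good, and it has ladder index 8, while (1,3) of index 9 stays. Hence the weaker
   invariant [admissible], whose inequalities survive the removal of any good box. Words and
   cancellations are replaced by partial sums, so that regrouping the letters by ladders amounts to
   cutting a height function at one point. The mirror side needs no second proof: transposition
   exchanges [a] with [b - a] and last maxima with first minima. A run is a relation that builds its
   result from the empty partition, so nothing can be read off the result in advance. Instead the
   profile of the column regularization is fixed beforehand, its co-good boxes are stripped in step
   with the good boxes until both diagrams are empty, and on the way back each box added by the run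
   is identified by a uniqueness argument. The part repeated [b] times is empty at every wall,
   because triangularity bounds the multiplicities. *)
Require Import Defs.
From mathcomp Require Import all_boot all_order all_algebra finmap zify ring.

Set Implicit Arguments.
Unset Strict Implicit.
Unset Printing Implicit Defensive.

Import Order.TTheory GRing.Theory Num.Theory.
Local Open Scope ring_scope.

(** * Profiles *)

(* A diagram is encoded by the function X such that (x, y) is a box iff
   x <= X (y - x): the boundary path meets the diagonal of content c at the
   vertex (X c, X c + c). It leaves that vertex eastwards if X (c + 1) = X c and
   northwards if X (c + 1) = X c - 1. *)
Definition profile_step (X : int -> int) : Prop :=
  forall c : int, X (c + 1) = X c \/ X (c + 1) = X c - 1.

(* Equal to 1 if the box of content c just outside the diagram is addable, to -1
   if the last box of content c is removable, and to 0 otherwise. *)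
Definition curv (X : int -> int) (c : int) : int :=
  X (c - 1) + X (c + 1) - X c - X c.

(* The ladder index of the boundary vertex; it is also that of the last box of
   content c. *)
Definition vindex (a b : int) (X : int -> int) (c : int) : int :=
  b * X c + a * c.

(** The profile left after taking off the last box of content [c0]. *)
Definition lower (X : int -> int) (c0 c : int) : int :=
  if c == c0 then X c - 1 else X c.

(* [adm_packed] says that every ladder is filled from its top end (a vertex on
   the west side is not constrained), and [adm_hook] that every hook whose length
   H is divisible by b has leg l with b (l + 1) <= a H. *)
Record admissible (a b : int) (X : int -> int) : Prop := Admissible {
  adm_step : profile_step X;
  adm_row : forall c : int, 0 <= X c;
  adm_col : forall c : int, 0 <= X c + c;
  adm_packed : forall c c' : int, c < c' -> (b %| c' - c)%Z -> 0 < X c + c ->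
    vindex a b X c <= vindex a b X c';
  adm_hook : forall c c' : int, c < c' -> (b %| c' - c)%Z ->
    X (c + 1) = X c -> X (c' + 1) = X c' - 1 ->
    vindex a b X c + b <= vindex a b X c' }.

Definition residue_class (b : int) (cls : int -> bool) : Prop :=
  forall c c' : int, cls c -> cls c' = (b %| c' - c)%Z.

Definition is_height (cls : int -> bool) (X h : int -> int) : Prop :=
  forall c : int, h (c + 1) = h c + (if cls c then curv X c else 0).

(* Reading the letters of a residue by increasing content, with A counted as 1
   and R as -1, the good box is the letter R that follows the last maximum of the
   partial sums. *)
Definition last_max (h : int -> int) (c0 : int) : Prop :=
  (forall c : int, c <= c0 -> h c <= h c0) /\ (forall c : int, c0 < c -> h c < h c0).

Lemma step_pred X (c : int) : profile_step X -> X (c - 1) = X c \/ X (c - 1) = X c + 1.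
Proof. by move=> st; have := st (c - 1); rewrite subrK; lia. Qed.

Lemma curv_cases X (c : int) : profile_step X ->
  [\/ curv X c = 0,
      [/\ curv X c = 1, X (c - 1) = X c + 1 & X (c + 1) = X c] |
      [/\ curv X c = -1, X (c - 1) = X c & X (c + 1) = X c - 1]].
Proof.
move=> st; rewrite /curv.
case: (step_pred c st) => ->; case: (st c) => ->.
- by apply: Or31; lia.
- by apply: Or33; split; lia.
- by apply: Or32; split; lia.
- by apply: Or31; lia.
Qed.

(** Used to produce letters A: a height rises only where an addable box is read. *)
Lemma increase_between (h : int -> int) (c d : int) : c <= d -> h c < h d ->
  exists2 e : int, c <= e < d & h e < h (e + 1).
Proof.
move=> cd; have -> : d = c + (`|d - c|%N)%:Z by lia.
elim: (`|d - c|%N) => [|k IH]; first by rewrite addr0 ltxx.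
move=> lt; have [/IH[e e1 e2]|le] := ltP (h c) (h (c + k%:Z)).
  by exists e => //; lia.
exists (c + k%:Z); first lia.
have -> : c + k%:Z + 1 = c + k.+1%:Z by lia.
exact: le_lt_trans le lt.
Qed.

Lemma dvdz_step (b d : int) : 0 < b -> (b %| d)%Z -> 0 < d -> b <= d.
Proof.
move=> b0 /dvdzP[q ->]; rewrite pmulr_lgt0 // => q0.
by rewrite ler_peMl //; lia.
Qed.

(** Within one residue class a strict inequality between ladder indices thus improves to a gap of
    [b]. *)
Lemma vindex_dvd a b X (c c' : int) : (b %| c' - c)%Z ->
  (b %| vindex a b X c' - vindex a b X c)%Z.
Proof.
case/dvdzP=> q e; apply/dvdzP; exists (X c' - X c + a * q).
have -> : c' = c + q * b by lia.
rewrite /vindex; lia.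
Qed.

(** * Removing a good box from an admissible profile *)

Section Good.

Variables (a b : int) (X : int -> int) (cls : int -> bool) (h : int -> int).
Hypotheses (a0 : 0 < a) (ab : a < b) (admX : admissible a b X).
Hypotheses (clsP : residue_class b cls) (hP : is_height cls X h).

Local Notation I := (vindex a b X).

Lemma vindex_gap (c : int) : X (c + 1) = X c -> I (c + 1) = I c + a.
Proof. by rewrite /vindex => ->; lia. Qed.

Lemma vindex_gap_pred (c : int) : X (c - 1) = X c -> I c = I (c - 1) + a.
Proof. by rewrite /vindex => ->; lia. Qed.

Lemma vindex_bead_pred (c : int) : X (c - 1) = X c + 1 -> I c = I (c - 1) + a - b.
Proof. by rewrite /vindex => ->; lia. Qed.

Lemma last_max_removable (c0 : int) : last_max h c0 ->
  [/\ cls c0, X (c0 - 1) = X c0 & X (c0 + 1) = X c0 - 1].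
Proof.
case=> _ /(_ (c0 + 1)); rewrite hP.
case: (cls c0) => /= [|/(_ _)]; last by lia.
by case: (curv_cases c0 (adm_step admX)) => [->|[-> _ _]|[-> -> ->]] //; lia.
Qed.

(** The R at [c] lowers the height below the maximum, which has to be regained by [c0]; only a
    letter A can do this. *)
Lemma addable_between (c c0 : int) : last_max h c0 -> c < c0 -> cls c ->
  X (c - 1) = X c -> X (c + 1) = X c - 1 ->
  exists c1 : int, [/\ c < c1 < c0, cls c1, X (c1 - 1) = X c1 + 1
                 & X (c1 + 1) = X c1].
Proof.
move=> [max1 _] cc0 cc e1 e2.
have cv : curv X c = -1 by rewrite /curv e1 e2; lia.
have hc : h (c + 1) = h c - 1 by rewrite hP cc cv.
have [||c1 c1P] := @increase_between h (c + 1) c0; first lia.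
  by have := max1 c (ltW cc0); lia.
rewrite hP; case c1c : (cls c1); last by rewrite addr0 ltxx.
case: (curv_cases c1 (adm_step admX)) => [->|[-> a1 a2]|[-> _ _]]; try lia.
by move=> _; exists c1; split=> //; lia.
Qed.

(** [adm_packed] alone gives no gap here. The extra [b] comes from a hook: directly if the boundary
    leaves [c] eastwards, through an intermediate A if [c] carries an R, and from the packing at
    [c - 1] and [c0 - 1] if the boundary is northward on both sides of [c]. *)
Lemma good_vindex_gap (c c0 : int) : last_max h c0 -> c < c0 -> cls c ->
  0 < X c + c -> I c + b <= I c0.
Proof.
move=> lm cc0 cc pos; have [cc' r1 r2] := last_max_removable lm.
have dv : (b %| c0 - c)%Z by rewrite -clsP.
case: (adm_step admX c) => [gap|bead]; first exact: (adm_hook admX).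
case: (step_pred c (adm_step admX)) => [gap'|bead'].
  (* The A at [c1] relays two hook inequalities, from [c - 1] to [c1 - 1] and from [c1] to [c0]; the
     index gains [a] from [c - 1] to [c] and [a - b] from [c1 - 1] to [c1]. *)
  have [c1 [c1P c1c a1 a2]] := addable_between lm cc0 cc gap' bead.
  have i1 : I (c - 1) + b <= I (c1 - 1).
    apply: (adm_hook admX); rewrite ?subrK //; try lia.
    (have -> : c1 - 1 - (c - 1) = c1 - c by lia); by rewrite -clsP.
  have i2 : I c1 + b <= I c0.
    by apply: (adm_hook admX) => //; [lia|rewrite -clsP].
  by have := vindex_gap_pred gap'; have := vindex_bead_pred a1; lia.
have i1 : I (c - 1) <= I (c0 - 1).
  apply: (adm_packed admX); rewrite ?bead'; try lia.
  by have -> : c0 - 1 - (c - 1) = c0 - c by lia.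
by have := vindex_bead_pred bead'; have := vindex_gap_pred r1; lia.
Qed.

(** The index at [c0] drops by [b]. On the left of an inequality this only helps, and turns the
    packing at [c0] into the hook inequality for the new eastward step; on the right it is
    compensated by [good_vindex_gap]. *)
Lemma lower_admissible (c0 : int) : last_max h c0 -> admissible a b (lower X c0).
Proof.
move=> lm; have [cc r1 r2] := last_max_removable lm.
have st := adm_step admX.
have gapb (c : int) : X (c + 1) = X c -> 0 < X (c + 1) + (c + 1).
  by move=> ->; have := adm_col admX c; lia.
have pos0 : 0 < X c0 + c0 by rewrite -r1; have := adm_col admX (c0 - 1); lia.
have Il (c : int) : vindex a b (lower X c0) c = I c - (if c == c0 then b else 0).
  by rewrite /vindex /lower; case: eqP => _; lia.
split.
- move=> c; rewrite /lower.
  case: eqP => e1; case: eqP => e2; try lia.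
  + (have -> : c = c0 - 1 by lia); by rewrite subrK r1; lia.
  + by rewrite e2; lia.
  + exact: st.
- move=> c; rewrite /lower; case: eqP => [->|_]; last exact: (adm_row admX).
  by have := adm_row admX (c0 + 1); lia.
- move=> c; rewrite /lower; case: eqP => [->|_]; last exact: (adm_col admX).
  lia.
- move=> c c' lt dv; rewrite !Il /lower.
  have [ec|nc] := eqVneq c c0.
    have -> : (c' == c0) = false by lia.
    subst c => _; have := adm_packed admX lt dv pos0; lia.
  move=> pc; have := adm_packed admX lt dv pc.
  have [ec'|nc'] := eqVneq c' c0; last lia.
  subst c'; have cl : cls c.
    rewrite (clsP _ cc); have -> : c - c0 = - (c0 - c) by lia.
    by rewrite rpredN.
  by have := good_vindex_gap lm lt cl pc; lia.
- move=> c c' lt dv; rewrite !Il.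
  have [ec|nc] := eqVneq c c0.
    subst c; have -> : (c' == c0) = false by lia.
    move=> _ _; have := adm_packed admX lt dv pos0; lia.
  (* After the removal the boundary leaves [c0] eastwards, so no hook has its northward step
     there. *)
  have [ec'|nc'] := eqVneq c' c0.
    subst c'; rewrite /lower eqxx.
    have -> : (c0 + 1 == c0) = false by lia.
    by rewrite r2; lia.
  move=> g1 g2; have gc : X (c + 1) = X c.
    move: g1; rewrite /lower (negPf nc); case: eqP => // e.
    (have -> : c = c0 - 1 by lia); by rewrite subrK r1; lia.
  have [ec'|nc1] := eqVneq (c' + 1) c0; last first.
    move: g2; rewrite /lower (negPf nc') (negPf nc1) => g2.
    by have := adm_hook admX lt dv gc g2; lia.
  (* Here [c' = c0 - 1] is the northward step created by the removal; its hook inequality is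
     [good_vindex_gap] at [c + 1] with [a] subtracted on both sides. *)
  have cl : cls (c + 1).
    rewrite (clsP _ cc); have -> : c + 1 - c0 = - (c' - c) by lia.
    by rewrite rpredN.
  have := good_vindex_gap lm _ cl (gapb _ gc); rewrite (vindex_gap gc) => /(_ _).
  have e : c' = c0 - 1 by lia.
  rewrite (vindex_gap_pred r1) e; lia.
Qed.

(** Two letters of the same kind are compared by [adm_packed], two of different kinds by [adm_hook],
    at contents shifted so that the relevant boundary steps appear. *)
Lemma letter_vindex_le (c c' : int) : c < c' -> cls c -> cls c' ->
  curv X c != 0 -> curv X c' != 0 -> I c <= I c'.
Proof.
move=> lt k k' n n'; have dv : (b %| c' - c)%Z by rewrite -clsP.
have dv1 : (b %| c' - 1 - (c - 1))%Z by have -> : c' - 1 - (c - 1) = c' - c by lia.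
have dv2 : (b %| c' + 1 - (c + 1))%Z by have -> : c' + 1 - (c + 1) = c' - c by lia.
have st := adm_step admX.
case: (curv_cases c st) n => [->//|[_ p1 p2]|[_ p1 p2]] _;
case: (curv_cases c' st) n' => [->//|[_ q1 q2]|[_ q1 q2]] _.
- have := @adm_packed _ _ _ admX (c + 1) (c' + 1).
  rewrite (vindex_gap p2) (vindex_gap q2) => H.
  suff : I c + a <= I c' + a by lia.
  by apply: H => //; [lia|have := adm_col admX c; lia].
- by have := adm_hook admX lt dv p2 q2; lia.
- have := @adm_hook _ _ _ admX (c - 1) (c' - 1).
  rewrite !subrK (vindex_gap_pred p1) (vindex_bead_pred q1) => H.
  suff : I (c - 1) + b <= I (c' - 1) by lia.
  by apply: H => //; lia.
- by apply: (adm_packed admX) => //; have := adm_col admX (c - 1); lia.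
Qed.

End Good.

(** * Matching profiles ladder by ladder *)

Definition range_sum (N : nat) (g : int -> int) : int :=
  \sum_(i < N.*2.+1) g (i%:Z - N%:Z).

(** The prescribed values are those of the empty diagram, [max(0, -c)]. *)
Definition supported (N : nat) (X : int -> int) : Prop :=
  forall c : int, (N%:Z <= c -> X c = 0) /\ (c <= - N%:Z -> X c = - c).

Definition ladder_height (a b : int) (N : nat) (cls : int -> bool)
    (X : int -> int) (e : int) : int :=
  range_sum N (fun c => if cls c && (vindex a b X c < e) then curv X c else 0).

(** The divisibility says that the ladder [e] has a lattice point of content [c]. Lattice points
    outside the positive quadrant satisfy both comparisons when [X] and [Z] represent diagrams, so
    they cancel, and [matched] compares the numbers of boxes ladder by ladder. *)
Definition ladder_diff (a b : int) (X Z : int -> int) (e c : int) : int :=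
  if (b %| e - a * c)%Z then
    (if e <= vindex a b X c then 1 else 0) -
    (if e <= vindex a b Z c then 1 else 0)
  else 0.

Definition matched (a b : int) (N : nat) (X Z : int -> int) : Prop :=
  forall e : int, range_sum N (ladder_diff a b X Z e) = 0.

(* The co-good box is the letter R that leads to the first minimum. *)
Definition first_min (h : int -> int) (c1 : int) : Prop :=
  (forall c : int, c <= c1 -> h (c1 + 1) < h c) /\
  (forall c : int, c1 < c -> h (c1 + 1) <= h c).

Lemma eq_range_sum N (f g : int -> int) :
  (forall c : int, - N%:Z <= c <= N%:Z -> f c = g c) ->
  range_sum N f = range_sum N g.
Proof.
move=> fg; apply: eq_bigr => i _; apply: fg.
by have := ltn_ord i; lia.
Qed.

Lemma range_sumD N (f g : int -> int) :
  range_sum N (fun c => f c + g c) = range_sum N f + range_sum N g.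
Proof. exact: big_split. Qed.

Lemma range_sumB N (f g : int -> int) :
  range_sum N (fun c => f c - g c) = range_sum N f - range_sum N g.
Proof. exact: sumrB. Qed.

Lemma range_sum_succ N (g : int -> int) :
  range_sum N (fun c => g (c + 1)) =
  range_sum N g + g (N%:Z + 1) - g (- N%:Z).
Proof.
rewrite /range_sum big_ord_recr [in RHS]big_ord_recl /=.
have -> : \sum_(i < N.*2) g (i%:Z - N%:Z + 1) =
          \sum_(i < N.*2) g ((bump 0 i)%:Z - N%:Z).
  by apply: eq_bigr => i _; congr g; rewrite /bump; lia.
have -> : N.*2%:Z - N%:Z + 1 = N%:Z + 1 by lia.
have -> : 0 - N%:Z = - N%:Z by lia.
by rewrite [RHS]addrC !addrA addNr add0r.
Qed.

Lemma range_sum_pred N (g : int -> int) :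
  range_sum N (fun c => g (c - 1)) =
  range_sum N g + g (- N%:Z - 1) - g N%:Z.
Proof.
have := range_sum_succ N (fun c => g (c - 1)); rewrite /= addrK.
rewrite (_ : range_sum N (fun c => g (c + 1 - 1)) = range_sum N g); last first.
  by apply: eq_range_sum => c _; rewrite addrK.
by move=> ->; rewrite subrK addrK.
Qed.

Lemma range_sum_opp N (g : int -> int) :
  range_sum N (fun c => g (- c)) = range_sum N g.
Proof.
rewrite /range_sum [RHS](reindex_inj rev_ord_inj) /=.
by apply: eq_bigr => i _; congr g; have := ltn_ord i; lia.
Qed.

Lemma range_sum_telescope N (h : int -> int) (ce : int) :
  - N%:Z <= ce <= N%:Z + 1 ->
  range_sum N (fun c => if c < ce then h (c + 1) - h c else 0) =
  h ce - h (- N%:Z).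
Proof.
move=> ceP.
have H (k : nat) : \sum_(i < k) (if i%:Z - N%:Z < ce
      then h (i%:Z - N%:Z + 1) - h (i%:Z - N%:Z) else 0) =
    h (if k%:Z - N%:Z < ce then k%:Z - N%:Z else ce) - h (- N%:Z).
  elim: k => [|k IH].
    rewrite big_ord0; have -> : 0%:Z - N%:Z = - N%:Z by lia.
    case: ltP => lt; first by rewrite subrr.
    have -> : ce = - N%:Z by lia.
    by rewrite subrr.
  rewrite big_ord_recr /= IH.
  have -> : k.+1%:Z - N%:Z = k%:Z - N%:Z + 1 by lia.
  case: (ltP (k%:Z - N%:Z) ce) => lt1; case: (ltP (k%:Z - N%:Z + 1) ce) => lt2.
  - by rewrite addrC subrKA.
  - have -> : ce = k%:Z - N%:Z + 1 by lia.
    by rewrite addrC subrKA.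
  - lia.
  - by rewrite addr0.
rewrite /range_sum H; case: ltP => lt //.
by have -> : ce = N.*2.+1%:Z - N%:Z by lia.
Qed.

Lemma supported_curv0 N X (c : int) : supported N X ->
  (c < - N%:Z) || (N%:Z < c) -> curv X c = 0.
Proof.
move=> sX /orP[lt|lt]; rewrite /curv.
  by rewrite (proj2 (sX (c - 1))) ?(proj2 (sX (c + 1))) ?(proj2 (sX c)); lia.
by rewrite (proj1 (sX (c - 1))) ?(proj1 (sX (c + 1))) ?(proj1 (sX c)); lia.
Qed.

Lemma height_left N X cls h (c : int) : supported N X -> is_height cls X h ->
  c <= - N%:Z -> h c = h (- N%:Z).
Proof.
move=> sX hP cN; have -> : c = - N%:Z - (`|- N%:Z - c|%N)%:Z by lia.
elim: (`|- N%:Z - c|%N) => [|k <-]; first by rewrite subr0.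
have -> : - N%:Z - k%:Z = - N%:Z - k.+1%:Z + 1 by lia.
rewrite hP (supported_curv0 sX); first by case: ifP; lia.
by apply/orP; left; lia.
Qed.

Lemma height_right N X cls h (c : int) : supported N X -> is_height cls X h ->
  N%:Z + 1 <= c -> h c = h (N%:Z + 1).
Proof.
move=> sX hP cN; have -> : c = N%:Z + 1 + (absz (c - (N%:Z + 1))%R)%:Z by lia.
elim: (absz (c - (N%:Z + 1))%R) => [|k <-]; first by rewrite addr0.
have -> : N%:Z + 1 + k.+1%:Z = N%:Z + 1 + k%:Z + 1 by lia.
rewrite hP (supported_curv0 sX); first by case: ifP; lia.
by apply/orP; right; lia.
Qed.

Lemma last_max_upto (h : int -> int) (c : int) (k : nat) :
  exists2 c0 : int, c <= c0 <= c + k%:Z &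
    (forall c' : int, c <= c' <= c0 -> h c' <= h c0) /\
    (forall c' : int, c0 < c' <= c + k%:Z -> h c' < h c0).
Proof.
elim: k => [|k [c0 c0P [m1 m2]]].
  exists c; first lia.
  by split=> c' P; [have -> : c' = c by lia | lia].
have [le|lt] := leP (h c0) (h (c + k.+1%:Z)).
  exists (c + k.+1%:Z); first lia.
  split=> c' P; last lia.
  have [->//|ne] := eqVneq c' (c + k.+1%:Z).
  apply: le_trans le; have [c1|c1] := leP c' c0; first by apply: m1; lia.
  by apply/ltW/m2; lia.
exists c0; first lia.
split=> // c' P; have [->//|ne] := eqVneq c' (c + k.+1%:Z).
by apply: m2; lia.
Qed.

Lemma range_bound (g : int -> int) (c : int) (k : nat) :
  exists M : int, forall c' : int, c <= c' < c + k%:Z -> g c' < M.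
Proof.
elim: k => [|k [M MP]]; first by exists 0 => c'; lia.
exists (Num.max M (g (c + k%:Z) + 1)) => c' P; rewrite lt_max.
have [->|ne] := eqVneq c' (c + k%:Z); first by apply/orP; right; lia.
by rewrite MP //; lia.
Qed.

(* In an admissible profile the letters of a residue, read by increasing content,
   lie on nondecreasing ladders, so that summing over the ladders up to a given
   one amounts to cutting the word. *)
Section LadderHeights.

Variables (a b : int) (N : nat) (X : int -> int) (cls : int -> bool).
Variable h : int -> int.
Hypotheses (a0 : 0 < a) (ab : a < b) (admX : admissible a b X).
Hypotheses (clsP : residue_class b cls) (hP : is_height cls X h).
Hypothesis sX : supported N X.

Local Notation I := (vindex a b X).
Local Notation S := (ladder_height a b N cls X).

Lemma ladder_cut (e : int) : exists2 ce : int, - N%:Z <= ce <= N%:Z + 1 &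
  forall c : int, - N%:Z <= c <= N%:Z -> cls c -> curv X c != 0 ->
    (I c < e) = (c < ce).
Proof.
have H (k : nat) : exists2 ce : int, - N%:Z <= ce <= - N%:Z + k%:Z &
    forall c : int, - N%:Z <= c < - N%:Z + k%:Z -> cls c -> curv X c != 0 ->
    (I c < e) = (c < ce).
  elim: k => [|k [ce ceP cut]]; first by exists (- N%:Z) => [|c]; lia.
  have [lt|ge] := boolP [&& cls (- N%:Z + k%:Z), curv X (- N%:Z + k%:Z) != 0
                          & I (- N%:Z + k%:Z) < e].
    exists (- N%:Z + k.+1%:Z); first lia.
    case/and3P: lt => l1 l2 l3 c cP c1 c2.
    have -> : c < - N%:Z + k.+1%:Z by lia.
    have [->//|ne] := eqVneq c (- N%:Z + k%:Z).
    apply: le_lt_trans l3.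
    by apply: (letter_vindex_le a0 ab admX clsP) => //; lia.
  exists ce; first lia.
  move=> c cP c1 c2; have [E|ne] := eqVneq c (- N%:Z + k%:Z).
    by move: ge; rewrite -E c1 c2 /= => /negPf ->; lia.
  by apply: cut => //; lia.
have [ce ceP cut] := H N.*2.+1.
exists ce; first lia.
by move=> c cP; apply: cut; lia.
Qed.

Lemma ladder_height_cut (e : int) : exists ce : int,
  [/\ - N%:Z <= ce <= N%:Z + 1,
      forall c : int, - N%:Z <= c <= N%:Z -> cls c -> curv X c != 0 ->
        (I c < e) = (c < ce)
    & S e = h ce - h (- N%:Z)].
Proof.
have [ce ceP cut] := ladder_cut e; exists ce; split=> //.
rewrite -(range_sum_telescope h ceP); apply: eq_range_sum => c cP.
rewrite hP; case cc: (cls c) => /=; last by rewrite addr0 subrr if_same.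
have [z|nz] := eqVneq (curv X c) 0; first by rewrite z addr0 subrr !if_same.
by rewrite cut //; case: ifP => _; lia.
Qed.

Lemma removable_range (c : int) : X (c - 1) = X c -> X (c + 1) = X c - 1 ->
  - N%:Z < c < N%:Z.
Proof.
move=> r1 r2; have [l1|l1] := leP N%:Z c.
  by have := adm_row admX (c + 1); rewrite r2 (proj1 (sX c)) //; lia.
have [l2|l2] := leP c (- N%:Z); last lia.
by move: r1; rewrite (proj2 (sX c)) // (proj2 (sX (c - 1))); lia.
Qed.

(** The cut at the ladder of [c0] may fall before [c0], but no A is lost in between: by [adm_hook]
    an A at [c < c0] has index at most that of [c0] minus [b]. So the height at the cut is already
    the maximum. *)
Lemma ladder_height_good (c0 : int) : last_max h c0 ->
  last_max S (I c0) /\ S (I c0) = h c0 - h (- N%:Z).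
Proof.
move=> lm; have [cc r1 r2] := last_max_removable a0 ab admX hP lm.
have c0N := removable_range r1 r2.
have cv : curv X c0 != 0 by rewrite /curv r1 r2; lia.
have SE : S (I c0) = h c0 - h (- N%:Z).
  have [ce [ceP cut ->]] := ladder_height_cut (I c0).
  have := cut c0 _ cc cv; rewrite ltxx => lt; have le : ce <= c0 by lia.
  suff : h c0 <= h ce by have := proj1 lm ce le; lia.
  rewrite leNgt; apply/negP => /(increase_between le)[c cP].
  rewrite hP; case k: (cls c); last by rewrite addr0 ltxx.
  case: (curv_cases c (adm_step admX)) => [->|[k1 k2 k3]|[-> _ _]]; try lia.
  have nz : curv X c != 0 by rewrite k1.
  have := cut c _ k nz; have := adm_hook admX _ _ k3 r2.
  by rewrite -(clsP _ k) cc; lia.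
split=> //; split=> e eP; rewrite SE.
  have [ce [ceP cut ->]] := ladder_height_cut e.
  have [l|l] := leP ce c0; first by have := proj1 lm ce l; lia.
  by have := proj2 lm ce l; lia.
have [ce [ceP cut ->]] := ladder_height_cut e.
have := cut c0 _ cc cv; rewrite eP => lt.
by have := proj2 lm ce; lia.
Qed.

(** The strict inequalities beyond [d] say that some R survives the cancellation: otherwise the last
    maximum of [h] would be reached only at the right end of the window. *)
Lemma good_exists (d : int) : last_max S d ->
  exists2 c0 : int, last_max h c0 & I c0 = d.
Proof.
move=> [m1 m2].
have [c0 c0P [n1 n2]] := last_max_upto h (- N%:Z) N.*2.+1.
have hL c := @height_left N X cls h c sX hP.
have hR c := @height_right N X cls h c sX hP.
have lt0 : c0 < N%:Z + 1.
  have [//|ge] := ltP c0 (N%:Z + 1).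
  have [M MP] := range_bound I (- N%:Z) N.*2.+1.
  (* A ladder beyond [d] and above every vertex of the window, so that the cut keeps the whole
     word. *)
  have := m2 (Num.max M (d + 1)); rewrite lt_max.
  have -> : d < d + 1 by lia.
  rewrite orbT => /(_ isT).
  have [ce [ceP cut ->]] := ladder_height_cut (Num.max M (d + 1)).
  have [cd [cdP _ ->]] := ladder_height_cut d.
  have E : h ce = h c0.
    apply/eqP; rewrite eq_le n1 /=; last lia.
    rewrite leNgt; apply/negP => lt.
    have [|c cP] := @increase_between h ce c0 _ lt; first lia.
    rewrite hP; case k: (cls c); last by rewrite addr0 ltxx.
    have [->|nz] := eqVneq (curv X c) 0; first by rewrite addr0 ltxx.
    have := cut c _ k nz; rewrite lt_max MP; last lia.
    lia.
  have := n1 cd; lia.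
have lm : last_max h c0.
  split=> c cP.
    have [l|l] := leP c (- N%:Z); last by apply: n1; lia.
    by rewrite (hL _ l); apply: n1; lia.
  have [l|l] := leP (N%:Z + 1) c; last by apply: n2; lia.
  by rewrite (hR _ l); apply: n2; lia.
exists c0 => //; have [[k1 k2] _] := ladder_height_good lm.
apply/eqP; rewrite eq_le !leNgt; apply/andP; split; apply/negP => l.
  by have := m2 _ l; have := k1 _ (ltW l); lia.
by have := k2 _ l; have := m1 _ (ltW l); lia.
Qed.

End LadderHeights.

(* Hence the signed number of letters (addable on the ladder e + b, removable on
   the ladder e) only depends on the numbers of boxes on four ladders. *)
Lemma curv_ladder (a b : int) (X : int -> int) (e c : int) :
  0 < a -> a < b -> profile_step X -> (b %| e - a * c)%Z ->
  (if vindex a b X c == e then curv X c else 0) =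
  (if e + b - a <= vindex a b X (c - 1) then 1 else 0) +
  (if e + a <= vindex a b X (c + 1) then 1 else 0) -
  (if e + b <= vindex a b X c then 1 else 0) -
  (if e <= vindex a b X c then 1 else 0).
Proof.
move=> a0 ab st /dvdzP[q eq].
have eE : e = q * b + a * c by lia.
have [k kE] : exists k, X c = q + k by exists (X c - q); lia.
have vE : vindex a b X c = e + k * b by rewrite /vindex kE eE; lia.
have v1 : vindex a b X (c - 1) = vindex a b X c - a + (X (c - 1) - X c) * b.
  by rewrite /vindex; lia.
have v2 : vindex a b X (c + 1) = vindex a b X c + a + (X (c + 1) - X c) * b.
  by rewrite /vindex; lia.
rewrite v1 v2 vE /curv {v1 v2 vE}.
(* The four indicators concern the square made of the point of content [c] on the ladder [e] and its
   south, east and southeast neighbours. It lies inside the diagram for [k >= 1] and outside for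
   [k <= -1]; for [k = 0] the first point is in, the last one out, and the sum is the curvature. *)
have [k0|[k1|k1]] : k = 0 \/ 1 <= k \/ k <= -1 by lia.
- subst k; rewrite mul0r addr0 eqxx.
  by case: (step_pred c st) => ->; case: (st c) => ->;
    do ![case: leP => ?]; lia.
- have kb : b <= k * b by nia.
  have -> : (e + k * b == e) = false by lia.
  by case: (step_pred c st) => ->; case: (st c) => ->;
    do ![case: leP => ?]; lia.
- have kb : k * b <= - b by nia.
  have -> : (e + k * b == e) = false by lia.
  by case: (step_pred c st) => ->; case: (st c) => ->;
    do ![case: leP => ?]; lia.
Qed.

(** * Equal ladder counts give equal ladder heights *)

Section Matching.

Variables (a b : int) (N : nat) (X Z : int -> int) (cls : int -> bool).
Hypotheses (a0 : 0 < a) (ab : a < b) (cop : coprimez a b).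
Hypotheses (stX : profile_step X) (stZ : profile_step Z).
Hypotheses (X0 : forall c, 0 <= X c) (Z0 : forall c, 0 <= Z c).
Hypotheses (sX : supported N X) (sZ : supported N Z).
Hypotheses (clsP : residue_class b cls) (mXZ : matched a b N X Z).

(** Coprimality makes [a] invertible modulo [b], so a ladder determines the residue of its
    points. *)
Lemma residue_ladder (e c0 c : int) : cls c0 -> (b %| e - a * c0)%Z ->
  cls c = (b %| e - a * c)%Z.
Proof.
move=> c0c d0; rewrite (clsP _ c0c).
have -> : e - a * c = (e - a * c0) - a * (c - c0) by lia.
rewrite [RHS](rpredBl _ d0) Gauss_dvdzr // coprimez_sym //.
Qed.

Lemma ladder_diff0 (e c : int) : (c <= - N%:Z) || (N%:Z <= c) ->
  ladder_diff a b X Z e c = 0.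
Proof.
move=> cP; have E : X c = Z c.
  case/orP: cP => cP; first by rewrite (proj2 (sX c)) // (proj2 (sZ c)).
  by rewrite (proj1 (sX c)) // (proj1 (sZ c)).
by rewrite /ladder_diff /vindex E subrr if_same.
Qed.

(** By [curv_ladder] the difference of the two sides is a combination of the differences of box
    counts on the ladders [e + b - a], [e + a], [e + b] and [e], all zero. Shifting the content
    costs boundary terms only, where both profiles are empty. *)
Lemma matched_curv_sum (e : int) :
  range_sum N (fun c => if cls c && (vindex a b X c == e) then curv X c else 0) =
  range_sum N (fun c => if cls c && (vindex a b Z c == e) then curv Z c else 0).
Proof.
have [/hasP[i iP c0c]|/hasPn nocls] :=
    boolP (has (fun i : nat => cls (i%:Z - N%:Z)) (iota 0 N.*2.+1)); last first.
  apply: eq_range_sum => c cP; suff -> : cls c = false by [].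
  apply/negbTE; have := nocls (absz (c + N%:Z)%R).
  rewrite mem_iota; have -> : (absz (c + N%:Z)%R)%:Z - N%:Z = c by lia.
  by apply; lia.
move: (i%:Z - N%:Z) c0c => c0 c0c {i iP}.
have [d0|nd0] := boolP (b %| e - a * c0)%Z; last first.
  have none Y c : cls c -> (vindex a b Y c == e) = false.
    move=> cc; apply/eqP => E; case/negP: nd0.
    have -> : e - a * c0 = b * Y c + a * (c - c0).
      by rewrite -E /vindex; lia.
    by apply: rpredD; [exact: dvdz_mulr | apply: dvdz_mull; rewrite -(clsP _ c0c)].
  apply: eq_range_sum => c _; case cc: (cls c) => //=.
  by rewrite !none.
have cE c := residue_ladder c c0c d0.
apply/eqP; rewrite -subr_eq0 -range_sumB; apply/eqP.
have -> : range_sum N (fun c =>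
    (if cls c && (vindex a b X c == e) then curv X c else 0) -
    (if cls c && (vindex a b Z c == e) then curv Z c else 0)) =
  range_sum N (fun c => ladder_diff a b X Z (e + b - a) (c - 1) +
    ladder_diff a b X Z (e + a) (c + 1) -
    ladder_diff a b X Z (e + b) c - ladder_diff a b X Z e c).
  apply: eq_range_sum => c _; rewrite /ladder_diff -cE.
  have -> : e + b - a - a * (c - 1) = e - a * c + b by lia.
  have -> : e + a - a * (c + 1) = e - a * c by lia.
  have -> : e + b - a * c = e - a * c + b by lia.
  rewrite (rpredDr _ (dvdzz b)) -cE.
  case cc: (cls c) => //=; have dv : (b %| e - a * c)%Z by rewrite -cE.
  by rewrite (curv_ladder a0 ab stX dv) (curv_ladder a0 ab stZ dv); ring.
rewrite !range_sumB range_sumD range_sum_succ range_sum_pred !mXZ.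
by rewrite !ladder_diff0 //; lia.
Qed.

Lemma matched_ladder_height (e : int) :
  ladder_height a b N cls X e = ladder_height a b N cls Z e.
Proof.
(* The induction on [e] starts at [- (a * N)], a lower bound for all vertex indices in the
   window. *)
have low Y : (forall c, 0 <= Y c) -> forall e' : int, e' <= - (a * N%:Z) ->
    ladder_height a b N cls Y e' = 0.
  move=> Y0 e' le; transitivity (range_sum N (fun=> 0)).
    apply: eq_range_sum => c cP.
    have yc : 0 <= b * Y c by apply: mulr_ge0; [lia|exact: Y0].
    have ac : - (a * N%:Z) <= a * c by nia.
    by rewrite /vindex; case: ltP => l; rewrite ?andbF //; lia.
  by rewrite /range_sum big1.
have up Y (e' : int) : ladder_height a b N cls Y (e' + 1) =
    ladder_height a b N cls Y e' + range_sum N (fun c =>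
      if cls c && (vindex a b Y c == e') then curv Y c else 0).
  rewrite /ladder_height -range_sumD; apply: eq_range_sum => c _.
  case: (cls c) => //=.
  by have [l|l|l] := ltgtP (vindex a b Y c) e'; case: ltP => l'; lia.
have [le|lt] := leP e (- (a * N%:Z)); first by rewrite !low.
have -> : e = - (a * N%:Z) + (absz (e + a * N%:Z)%R)%:Z by lia.
elim: (absz _) => [|k IH]; first by rewrite addr0 !low.
have -> : - (a * N%:Z) + k.+1%:Z = - (a * N%:Z) + k%:Z + 1 by lia.
by rewrite !up IH matched_curv_sum.
Qed.

End Matching.

(** * Transposition of profiles, and co-good boxes *)

Definition tr (X : int -> int) (c : int) : int := X (- c) - c.

Lemma vindex_tr a b X (c : int) : vindex (b - a) b (tr X) c = vindex a b X (- c).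
Proof. by rewrite /vindex /tr; lia. Qed.

Lemma curv_tr X (c : int) : curv (tr X) c = curv X (- c).
Proof.
rewrite /curv /tr; have -> : - (c - 1) = - c + 1 by lia.
have -> : - (c + 1) = - c - 1 by lia.
ring.
Qed.

Lemma profile_step_tr X : profile_step (tr X) <-> profile_step X.
Proof.
split=> st c; rewrite /tr.
  have := st (- c - 1); rewrite /tr.
  have -> : - (- c - 1 + 1) = c by lia.
  have -> : - (- c - 1) = c + 1 by lia.
  lia.
have := step_pred (- c) st; have -> : - c - 1 = - (c + 1) by lia.
lia.
Qed.

Lemma supported_tr N X : supported N X -> supported N (tr X).
Proof.
move=> sX c; rewrite /tr; split=> cP.
  by rewrite (proj2 (sX (- c))); lia.
by rewrite (proj1 (sX (- c))); lia.
Qed.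

Lemma ladder_height_tr a b N cls X (e : int) :
  ladder_height (b - a) b N (fun c => cls (- c)) (tr X) e =
  ladder_height a b N cls X e.
Proof.
rewrite /ladder_height -[RHS]range_sum_opp; apply: eq_range_sum => c _.
by rewrite vindex_tr curv_tr.
Qed.

(** Transposing reverses the word, and the sign turns maxima into minima. The shift by 1 makes the
    value at [d] equal to [- h (- d + 1)], so that a last maximum at [d] is a [first_min] of [h] at
    [- d]. *)
Lemma is_height_tr cls X h : is_height cls X h ->
  is_height (fun c => cls (- c)) (tr X) (fun c => - h (1 - c)).
Proof.
move=> hP c; rewrite curv_tr; have := hP (- c).
have -> : - c + 1 = 1 - c by lia.
have -> : 1 - (c + 1) = - c by lia.
lia.
Qed.

Lemma residue_class_tr b cls : residue_class b cls ->
  residue_class b (fun c => cls (- c)).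
Proof.
move=> clsP c c' cc; rewrite (clsP _ _ cc).
have -> : - c' - - c = - (c' - c) by lia.
exact: rpredN.
Qed.

Lemma admissible_ext a b X Y : X =1 Y -> admissible a b X -> admissible a b Y.
Proof.
move=> XY [A1 A2 A3 A4 A5]; have v c : vindex a b Y c = vindex a b X c.
  by rewrite /vindex XY.
split.
- by move=> c; rewrite -!XY; apply: A1.
- by move=> c; rewrite -!XY; apply: A2.
- by move=> c; rewrite -!XY; apply: A3.
- by move=> c c'; rewrite -!XY !v; apply: A4.
- by move=> c c'; rewrite -!XY !v; apply: A5.
Qed.

Lemma matched_lower (a b : int) N X Z (c0 c1 : int) : 0 < b ->
  - N%:Z <= c0 <= N%:Z -> - N%:Z <= c1 <= N%:Z ->
  vindex a b X c0 = vindex a b Z c1 ->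
  matched a b N X Z -> matched a b N (lower X c0) (lower Z c1).
Proof.
move=> b0 c0N c1N E mXZ e.
have low Y (d c : int) : (b %| e - a * c)%Z ->
    (if e <= vindex a b (lower Y d) c then 1 else 0) =
    (if e <= vindex a b Y c then 1 else 0) -
    (if (c == d) && (e == vindex a b Y d) then 1 else 0) :> int.
  move=> /dvdzP[q qE]; rewrite /vindex /lower.
  have [cd|_] := eqVneq c d; last by rewrite subr0.
  rewrite {}cd in qE *.
  have vE : b * Y d + a * d - e = b * (Y d - q) by lia.
  have v1 : b * (Y d - 1) + a * d - e = b * (Y d - 1 - q) by lia.
  have [kq|[kq|kq]] : Y d = q \/ q + 1 <= Y d \/ Y d <= q - 1 by lia.
  - rewrite kq in vE v1 *; have -> : e == b * q + a * d by lia.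
    by rewrite /=; do ![case: leP => ?]; lia.
  - have ge : 0 <= b * (Y d - 1 - q) by apply: mulr_ge0; lia.
    have -> : (e == b * Y d + a * d) = false by nia.
    by rewrite /=; do ![case: leP => ?]; lia.
  - have le : b * (Y d - q) <= - b by nia.
    have -> : (e == b * Y d + a * d) = false by lia.
    by rewrite /=; do ![case: leP => ?]; lia.
have ind (d : int) (v : int) : - N%:Z <= d <= N%:Z ->
    range_sum N (fun c => if (b %| e - a * c)%Z then
      (if (c == d) && (e == v) then 1 else 0) else 0) =
    if (b %| e - a * d)%Z && (e == v) then 1 else 0.
  move=> dN; pose i0 : 'I_(N.*2.+1) := inord (absz (d + N%:Z)%R).
  have i0E : i0%:Z - N%:Z = d by rewrite /i0 inordK; lia.
  rewrite /range_sum (bigD1 i0) //= i0E eqxx big1 ?addr0.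
    by case: (_ %| _)%Z.
  move=> i ne; case: ifP => // _; suff -> : (i%:Z - N%:Z == d) = false by [].
  by apply/negbTE; apply: contraNneq ne => E'; apply/eqP/val_inj => /=; lia.
transitivity (range_sum N (fun c => ladder_diff a b X Z e c -
   (if (b %| e - a * c)%Z then
      (if (c == c0) && (e == vindex a b X c0) then 1 else 0) else 0) +
   (if (b %| e - a * c)%Z then
      (if (c == c1) && (e == vindex a b Z c1) then 1 else 0) else 0))).
  apply: eq_range_sum => c _; rewrite /ladder_diff.
  by case: ifP => // dv; rewrite !low //; ring.
rewrite range_sumD range_sumB mXZ !ind // -E sub0r.
case: (e =P _) => [eE|_]; last by rewrite !andbF oppr0 addr0.
have d0 : (b %| e - a * c0)%Z by rewrite eE /vindex addrK dvdz_mulr.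
have d1 : (b %| e - a * c1)%Z by rewrite eE E /vindex addrK dvdz_mulr.
by rewrite d0 d1 addNr.
Qed.

(** The removal also lowers the curvature at [c0 - 1] and [c0 + 1], but these belong to other
    residues since [b > 1]. *)
Lemma lower_curv (b : int) cls Z (c0 c : int) : 1 < b -> residue_class b cls ->
  cls c0 -> cls c ->
  curv (lower Z c0) c = curv Z c + (if c == c0 then 2 else 0).
Proof.
move=> b1 clsP k0 k; rewrite /curv /lower.
have dv : (b %| c - c0)%Z by rewrite -(clsP _ _ k0).
have ne (s : int) : s = 1 \/ s = -1 -> (c + s == c0) = false.
  move=> s1; apply/eqP => E; have : (b %| - s)%Z.
    by have -> : - s = c - c0 by lia.
  by case: s1 => ->; rewrite ?opprK ?rpredN dvdz1; lia.
by rewrite !ne; [case: eqP => _; lia|lia|lia].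
Qed.

(** The two words differ only at [c1] and [c2]. If [c1 < c2], then [hW - hZ] is larger by 2 at [c2]
    than at [c1]; a first minimum of [hW] reached just after [c2] then forces [hZ c2 < hZ (c1 + 1)],
    against the minimality at [c1]. *)
Lemma first_min_unique (b : int) cls Z W hZ hW (c1 c2 : int) : 1 < b ->
  residue_class b cls -> profile_step Z -> profile_step W ->
  is_height cls Z hZ -> is_height cls W hW ->
  cls c1 -> cls c2 -> first_min hZ c1 -> first_min hW c2 ->
  lower Z c1 =1 lower W c2 -> c1 = c2.
Proof.
move=> b1 clsP.
wlog lt : Z W hZ hW c1 c2 / c1 < c2.
  move=> H sZ sW hZP hWP k1 k2 m1 m2 E.
  have [l|l|//] := ltgtP c1 c2; first exact: (H Z W hZ hW).
  by apply/esym/(H W Z hW hZ) => // c; rewrite E.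
move=> sZ sW hZP hWP k1 k2 [m1 m1'] [m2 m2'] E; exfalso.
have cE c : cls c -> curv Z c + (if c == c1 then 2 else 0) =
                     curv W c + (if c == c2 then 2 else 0).
  move=> k; rewrite -(lower_curv Z b1 clsP k1 k) -(lower_curv W b1 clsP k2 k).
  by rewrite /curv !E.
pose u c := hW c - hZ c.
have uE (c : int) : u (c + 1) =
    u c + (if c == c1 then 2 else 0) - (if c == c2 then 2 else 0).
  rewrite /u hZP hWP; case k: (cls c).
    by have := cE c k; do ![case: ifP => ?]; lia.
  have -> : (c == c1) = false by apply: contraFF k => /eqP ->.
  have -> : (c == c2) = false by apply: contraFF k => /eqP ->.
  lia.
have u1 : u (c1 + 1) = u c1 + 2.
  by rewrite uE eqxx; have -> : (c1 == c2) = false by [lia]; lia.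
have u2 : u (c2 + 1) = u c2 - 2.
  by rewrite uE eqxx; have -> : (c2 == c1) = false by [lia]; lia.
have u3 : u c2 = u (c1 + 1).
  have -> : c2 = c1 + 1 + (absz (c2 - c1 - 1)%R)%:Z by lia.
  have : (absz (c2 - c1 - 1)%R)%:Z <= c2 - c1 - 1 by lia.
  elim: (absz _) => [|k IH] kP; first by rewrite addr0.
  have -> : c1 + 1 + k.+1%:Z = c1 + 1 + k%:Z + 1 by lia.
  rewrite uE IH; last lia.
  have -> : (c1 + 1 + k%:Z == c1) = false by lia.
  have -> : (c1 + 1 + k%:Z == c2) = false by lia.
  lia.
have := m1' c2 lt; have := m2 c1 (ltW lt); have := m2 c2 (lexx _).
have := m1 c1 (lexx _); move: u1 u2 u3; rewrite /u.
have hd : hZ (c1 + 1) = hZ c1 + curv Z c1 by rewrite hZP k1.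
have he : hW (c2 + 1) = hW c2 + curv W c2 by rewrite hWP k2.
have cv Y (c : int) : profile_step Y -> -1 <= curv Y c.
  by move=> st; case: (curv_cases c st) => [->|[-> _ _]|[-> _ _]].
by have := cv _ c1 sZ; have := cv _ c2 sW; lia.
Qed.

(** The ladder heights of [X] and [Z] agree, so the last maximum at the ladder of [c0] is also one
    for the transpose of [Z]; there [good_exists] finds a good box on that ladder, which is a
    co-good box for [Z] itself. *)
Lemma cogood_match (a b : int) N X Z cls hX hZ (c0 : int) :
  0 < a -> a < b -> coprimez a b ->
  admissible a b X -> admissible (b - a) b (tr Z) ->
  supported N X -> supported N Z -> matched a b N X Z ->
  residue_class b cls -> is_height cls X hX -> is_height cls Z hZ ->
  last_max hX c0 ->
  exists c1 : int,
    [/\ first_min hZ c1, cls c1,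
        admissible (b - a) b (tr (lower Z c1)),
        supported N (lower X c0) /\ supported N (lower Z c1)
      & matched a b N (lower X c0) (lower Z c1)].
Proof.
move=> a0 ab cop admX admZ sX sZ mXZ clsP hXP hZP lm.
have sl Y (c : int) : supported N Y -> - N%:Z < c < N%:Z -> supported N (lower Y c).
  move=> sY cN d; rewrite /lower.
  by case: eqP => [->|_]; [split; lia|exact: sY].
have [k0 r1 r2] := last_max_removable a0 ab admX hXP lm.
have c0N := removable_range a0 ab admX sX r1 r2.
have [lmS _] := ladder_height_good a0 ab admX clsP hXP sX lm.
have hS e : ladder_height a b N cls X e =
    ladder_height (b - a) b N (fun c => cls (- c)) (tr Z) e.
  rewrite ladder_height_tr; apply: matched_ladder_height => //.
  - exact: (adm_step admX).
  - exact/profile_step_tr/(adm_step admZ).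
  - exact: (adm_row admX).
  - by move=> c; have := adm_col admZ (- c); rewrite /tr opprK; lia.
have a0' : 0 < b - a by lia.
have ab' : b - a < b by lia.
have [] := @good_exists (b - a) b N (tr Z) _ _ a0' ab' admZ
  (residue_class_tr clsP) (is_height_tr hZP) (supported_tr sZ)
  (vindex a b X c0).
  by case: lmS => m1 m2; split=> e; rewrite -!hS; [exact: m1|exact: m2].
move=> d lmZ dE; exists (- d).
have [kd s1 s2] := last_max_removable a0' ab' admZ (is_height_tr hZP) lmZ.
have dN := removable_range a0' ab' admZ (supported_tr sZ) s1 s2.
split=> //.
- case: lmZ => m1 m2; split=> c cP.
    have /= := m2 (1 - c); rewrite subKr [1 - d]addrC ltrN2.
    by apply; lia.
  have /= := m1 (1 - c); rewrite subKr [1 - d]addrC lerN2.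
  by apply; lia.
- apply: admissible_ext (lower_admissible a0' ab' admZ
     (residue_class_tr clsP) (is_height_tr hZP) lmZ).
  move=> c; rewrite /tr /lower eqr_opp.
  by case: eqP => _ //; lia.
- by split; apply: sl => //; lia.
- apply: matched_lower => //; try lia.
  by rewrite -dE vindex_tr.
Qed.

(** * Partitions and their profiles *)

Definition positive (D : pred box) : Prop :=
  forall x y : nat, D (x, y) -> (0 < x)%N /\ (0 < y)%N.

Definition downset (D : pred box) : Prop :=
  positive D /\
  forall x y x' y' : nat, (0 < x' <= x)%N -> (0 < y' <= y)%N ->
    D (x, y) -> D (x', y').

Definition bounded (N : nat) (D : pred box) : Prop :=
  forall x y : nat, D (x, y) -> (x <= N)%N /\ (y <= N)%N.

Record represents (D : pred box) (X : int -> int) : Prop := Represents {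
  repr_mem : forall x y : nat, (0 < x)%N -> (0 < y)%N ->
    D (x, y) = (x%:Z <= X (y%:Z - x%:Z));
  repr_row : forall c : int, 0 <= X c;
  repr_col : forall c : int, 0 <= X c + c }.

(** [m] is [max(0, -c)]: the diagonal of content [c] enters the positive quadrant in row [m + 1].
    From there the first point outside [D] is searched, with at most [N] trials. *)
Definition profile (N : nat) (D : pred box) (c : int) : int :=
  let m := (if c is Negz k then k.+1 else 0)%N in
  (m + find (fun k : nat => ~~ D ((m + k).+1, absz ((m + k).+1%:Z + c)%R))
            (iota 0 N))%N%:Z.

Lemma profile_represents N D : downset D -> bounded N D ->
  represents D (profile N D).
Proof.
move=> [pos dn] bd; split.
- move=> x y x0 y0; rewrite /profile.
  set c := y%:Z - x%:Z; set m := (if c is Negz k then k.+1 else 0)%N.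
  have mE : m%:Z = Num.max 0 (- c).
    by rewrite /m /c; case: (y%:Z - x%:Z) => k; lia.
  have mx : (m < x)%N by rewrite /c in mE; lia.
  set f := find _ _.
  have kE (k : nat) : absz ((m + k).+1%:Z + c)%R = ((m + k).+1 + y - x)%N.
    by rewrite /c in mE *; lia.
  apply/idP/idP => [Dxy|le].
    rewrite lez_nat leqNgt; apply/negP => lt.
    have fN : (f < N)%N by have [] := bd _ _ Dxy; lia.
    have fs : (f < size (iota 0 N))%N by rewrite size_iota.
    have := nth_find 0%N; rewrite -/f => /(_ _ _) H.
    have hs : has (fun k : nat => ~~ D ((m + k).+1, absz ((m + k).+1%:Z + c)%R))
       (iota 0 N) by rewrite has_find.
    move: (H _ _ hs); rewrite -/f nth_iota // add0n kE => /negP; apply.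
    by apply: dn Dxy; lia.
  have lt : (x - m.+1 < f)%N by lia.
  have := before_find 0%N lt; rewrite nth_iota; last first.
    by apply: leq_trans lt _; rewrite -[X in (_ <= X)%N](size_iota 0) find_size.
  move/negbFE; rewrite add0n kE.
  by have -> : ((m + (x - m.+1)).+1 = x)%N by [lia];
     have -> : (x + y - x = y)%N by lia.
- by move=> c; rewrite /profile; lia.
- by move=> c; rewrite /profile; case: c => k; lia.
Qed.

(** A rise of [X] would give a box without its western neighbour, a drop by more than 1 a box
    without its northern neighbour. *)
Lemma represents_step D X : downset D -> represents D X -> profile_step X.
Proof.
move=> [_ dn] [mem row col] c.
have r0 := row c; have r1 := row (c + 1).
have k0 := col c; have k1 := col (c + 1).
have up : X (c + 1) <= X c.
  rewrite leNgt; apply/negP => lt.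
  have D1 : D (absz (X c + 1)%R, absz (X c + c + 2)%R).
    rewrite mem; try lia.
    have -> : (absz (X c + c + 2)%R)%:Z - (absz (X c + 1)%R)%:Z = c + 1 by lia.
    lia.
  have : D (absz (X c + 1)%R, absz (X c + c + 1)%R) by apply: dn D1; lia.
  rewrite mem; try lia.
  have -> : (absz (X c + c + 1)%R)%:Z - (absz (X c + 1)%R)%:Z = c by lia.
  lia.
suff : X c - 1 <= X (c + 1) by lia.
rewrite leNgt; apply/negP => lt.
have D1 : D (absz (X c), absz (X c + c)%R).
  rewrite mem; try lia.
  have -> : (absz (X c + c)%R)%:Z - (absz (X c))%:Z = c by lia.
  lia.
have : D (absz (X c - 1)%R, absz (X c + c)%R) by apply: dn D1; lia.
rewrite mem; try lia.
have -> : (absz (X c + c)%R)%:Z - (absz (X c - 1)%R)%:Z = c + 1 by lia.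
lia.
Qed.

Lemma represents_supported N D X : downset D -> bounded N D ->
  represents D X -> supported N X.
Proof.
move=> [_ dn] bd [mem row col] c; have r0 := row c; have k0 := col c.
have [E|ne] := eqVneq (X c) (Num.max 0 (- c)); first by rewrite E; lia.
have : D (absz (X c), absz (X c + c)%R).
  rewrite mem; try lia.
  have -> : (absz (X c + c)%R)%:Z - (absz (X c))%:Z = c by lia.
  lia.
by case/bd; lia.
Qed.

Lemma represents_eq D E X Y : represents D X -> represents E Y ->
  (forall x y : nat, (0 < x)%N -> (0 < y)%N -> D (x, y) = E (x, y)) -> X =1 Y.
Proof.
move=> [m1 r1 k1] [m2 r2 k2] DE c.
have H (c' : int) (x : int) : 0 < x -> 0 < x + c' -> (x <= X c') = (x <= Y c').
  move=> x0 y0.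
  have := DE (absz x) (absz (x + c')%R); rewrite m1 ?m2; try lia.
  have -> : (absz (x + c')%R)%:Z - (absz x)%:Z = c' by lia.
  by have -> : (absz x)%:Z = x by [lia]; apply; lia.
have := r1 c; have := r2 c; have := k1 c; have := k2 c.
have := H c (X c); have := H c (Y c); rewrite !lexx.
by have [||] := ltgtP (X c) (Y c); lia.
Qed.

(** * Lists of rows, and their removable and addable boxes *)

Lemma partitionP (s : seq nat) : reflect
  ((forall i, (nth 0 s i.+1 <= nth 0 s i)%N) /\
   (forall i, (i < size s)%N -> (0 < nth 0 s i)%N))
  (is_partition s).
Proof.
apply: (iffP andP) => [[/(sortedP 0%N) so z]|[so pos]]; split.
- move=> i; have [lt|ge] := ltnP i.+1 (size s); first exact: so.
  by rewrite nth_default.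
- move=> i lt; rewrite lt0n; apply: contraNneq z => <-; exact: mem_nth.
- by apply/(sortedP 0%N) => i _; apply: so.
- by apply/negP => /(nthP 0%N)[i lt E]; have := pos i lt; rewrite E.
Qed.

Lemma partition_nth_le s i j : is_partition s -> (i <= j)%N ->
  (nth 0 s j <= nth 0 s i)%N.
Proof.
move=> /partitionP[so _] /subnK <-.
by elim: (j - i)%N => //= k; apply: leq_trans; apply: so.
Qed.

Lemma mem_boxes (la : seq nat) x y : ((x, y) \in boxes la) =
  [&& 0 < x, 0 < y & y <= nth 0 la x.-1]%N.
Proof.
apply/allpairsPdep/and3P => [[i [j [+ + [-> ->]]]]|[x0 y0 le]].
  by rewrite !mem_iota => ? ?; split; lia.
exists x, y; split=> //; rewrite !mem_iota; last lia.
have [lt|ge] := ltnP x.-1 (size la); first lia.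
by move: le; rewrite nth_default //; lia.
Qed.

Lemma boxes_uniq la : uniq (boxes la).
Proof.
apply: allpairs_uniq_dep => [|i _|]; rewrite ?iota_uniq //.
by case=> ? ? [? ?] _ _ [-> ->].
Qed.

Lemma size_add_uniq (s t : seq box) (B : box) : uniq s -> uniq t ->
  B \notin s -> (forall C, (C \in t) = (C == B) || (C \in s)) ->
  size t = (size s).+1.
Proof.
move=> us ut Bs E; apply: (perm_size (s2 := B :: s)).
by apply: uniq_perm => //=; rewrite ?Bs ?us // => C; rewrite inE E.
Qed.

Lemma partition_downset la : is_partition la -> downset (mem (boxes la)).
Proof.
move=> pl; split=> x y; rewrite /= mem_boxes; first by case/and3P.
move=> x' y' xP yP; rewrite mem_boxes.
have := @partition_nth_le la x'.-1 x.-1 pl; lia.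
Qed.

Lemma box_bound la x y : is_partition la -> (x, y) \in boxes la ->
  (x <= size la)%N /\ (y <= head 0 la)%N.
Proof.
move=> pl; rewrite mem_boxes => /and3P[x0 y0 le].
have := partition_nth_le pl (leq0n x.-1); rewrite nth0 => le'.
have [lt|ge] := ltnP x.-1 (size la); first lia.
by move: le; rewrite nth_default //; lia.
Qed.

Lemma partition_bounded la : is_partition la ->
  bounded (size la + head 0 la)%N (mem (boxes la)).
Proof. by move=> pl x y /(box_bound pl); lia. Qed.

Lemma partition_eq la mu : is_partition la -> is_partition mu ->
  (forall x y, ((x, y) \in boxes la) = ((x, y) \in boxes mu)) -> la = mu.
Proof.
move=> pl pm E.
have nE i : nth 0%N la i = nth 0%N mu i.
  have := E i.+1 (nth 0 la i)%N; have := E i.+1 (nth 0 mu i)%N.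
  by rewrite !mem_boxes /= !leqnn; lia.
have sz : size la = size mu.
  have /partitionP[_ p1] := pl; have /partitionP[_ p2] := pm.
  have [lt|lt|//] := ltngtP (size la) (size mu).
    by have := p2 _ lt; rewrite -nE nth_default.
  by have := p1 _ lt; rewrite nE nth_default.
by apply: (eq_from_nth (x0 := 0%N)).
Qed.

Lemma removableE la B : is_partition la -> removable la B =
  [&& B \in boxes la, (B.1.+1, B.2) \notin boxes la
    & (B.1, B.2.+1) \notin boxes la].
Proof.
case: B => i j pl; rewrite /removable !mem_boxes /=.
have so := proj1 (partitionP _ pl).
apply/and3P/and3P => [[bx /eqP E /(sortedP 0%N) so']|[bx b1 b2]].
  split=> //; last lia.
  have := so' i.-1; rewrite size_set_nth !nth_set_nth /= eqxx.
  rewrite (ltn_predK (m := 0)); last lia.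
  have -> : (i == i.-1) = false by lia.
  have [ge|lt] := leqP (size la) i; first by rewrite nth_default; lia.
  lia.
have E : j = nth 0%N la i.-1 by lia.
split=> //; first by rewrite -E.
apply/(sortedP 0%N) => k; rewrite size_set_nth !nth_set_nth /= => _.
have := so k; have [k1|k1] := eqVneq k i.-1; have [k2|k2] := eqVneq k.+1 i.-1;
  rewrite ?k1 ?k2; try lia.
have -> : i.-1.+1 = i by lia.
lia.
Qed.

Lemma addableE la B : is_partition la -> addable la B =
  [&& 0 < B.1, 0 < B.2, B \notin boxes la,
      (B.1 == 1) || ((B.1.-1, B.2) \in boxes la)
    & (B.2 == 1) || ((B.1, B.2.-1) \in boxes la)]%N.
Proof.
case: B => i j pl; rewrite /addable !mem_boxes /=.
have so := proj1 (partitionP _ pl); have po := proj2 (partitionP _ pl).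
apply/and3P/and5P => [[i0 /eqP jE /partitionP[so' po']]|[i0 j0 n1 o1 o2]].
  split=> //; try lia.
  have := so' i.-2; rewrite /add_box !nth_set_nth /=.
  have [//|ne] := eqVneq i 1%N.
  have -> : i.-2.+1 = i.-1 by lia.
  by rewrite eqxx; have -> : (i.-2 == i.-1) = false by [lia]; lia.
have jE : j = (nth 0%N la i.-1).+1 by lia.
split=> //; first by rewrite -jE.
have il : (i.-1 <= size la)%N.
  have [//|ge] := leqP i.-1 (size la).
  by move: o1; rewrite nth_default; lia.
apply/partitionP; rewrite /add_box; split=> k; rewrite ?size_set_nth !nth_set_nth /=.
  have := so k; have [k1|k1] := eqVneq k i.-1; have [k2|k2] := eqVneq k.+1 i.-1;
    rewrite ?k1; try lia.
  have -> : k = i.-2 by lia.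
  lia.
by case: eqP => k1 kl; [lia|apply: po; lia].
Qed.

Lemma mem_add_box la B : addable la B -> is_partition (add_box la B) /\
  forall x y, ((x, y) \in boxes (add_box la B)) =
              ((x, y) == B) || ((x, y) \in boxes la).
Proof.
case: B => i j /and3P[/= i0 /eqP jE pl]; split=> // x y.
rewrite !mem_boxes /add_box nth_set_nth /= xpair_eqE.
by have [k1|k1] := eqVneq x.-1 i.-1; rewrite ?k1; lia.
Qed.

Lemma nth_filter_gt0 (s : seq nat) k : sorted geq s ->
  nth 0%N [seq x <- s | (0 < x)%N] k = nth 0%N s k.
Proof.
elim: s k => //= x s IH k px; have so := path_sorted px.
case: posnP => [x0|x0] /=; last by case: k => //= k; apply: IH.
have all0 : all (fun y => y == 0)%N s.
  have tr : transitive geq by move=> ? ? ? /= h1 h2; apply: leq_trans h2 h1.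
  have := order_path_min tr px; apply: sub_all => y /=; lia.
rewrite IH //; have s0 i : nth 0%N s i = 0%N.
  have [lt|ge] := ltnP i (size s); last by rewrite nth_default.
  by apply/eqP/(allP all0)/mem_nth.
by rewrite s0; case: k => //= k; rewrite s0.
Qed.

Lemma mem_del_box la B : is_partition la -> removable la B ->
  is_partition (del_box la B) /\
  forall x y, ((x, y) \in boxes (del_box la B)) =
              ((x, y) != B) && ((x, y) \in boxes la).
Proof.
case: B => i j pl /and3P[/= bx /eqP jE so]; split=> [|x y].
  rewrite /is_partition /del_box mem_filter ltnn /= andbT.
  apply: sorted_filter so => ? ? ? /= h1 h2; exact: leq_trans h2 h1.
move: bx; rewrite !mem_boxes /del_box nth_filter_gt0 // nth_set_nth /= xpair_eqE.
by have [k1|k1] := eqVneq x.-1 i.-1; rewrite ?k1; lia.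
Qed.

Section Letters.

Variables (la : seq nat) (X : int -> int).
Hypotheses (pl : is_partition la) (rX : represents (mem (boxes la)) X).

Let st : profile_step X := represents_step (partition_downset pl) rX.

Definition rbox (c : int) : box := (absz (X c), absz (X c + c)%R).
Definition abox (c : int) : box := (absz (X c + 1)%R, absz (X c + 1 + c)%R).

Lemma removableP B :
  reflect (exists2 c : int, curv X c = -1 & B = rbox c) (removable la B).
Proof.
have [mem row col] := rX; case: B => i j; rewrite removableE //=.
apply: (iffP and3P) => [[b0 b1 b2]|[c cv [-> ->]]].
  move: (b0); rewrite mem_boxes => /and3P[i0 j0 _].
  have := mem i j i0 j0; rewrite /= b0 => /esym h0.
  have := mem i.+1 j isT j0; rewrite /= (negPf b1) => /esym h1.
  have := mem i j.+1 i0 isT; rewrite /= (negPf b2) => /esym h2.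
  set c : int := j%:Z - i%:Z.
  have e1 : j%:Z - i.+1%:Z = c - 1 by rewrite /c; lia.
  have e2 : j.+1%:Z - i%:Z = c + 1 by rewrite /c; lia.
  rewrite -/c in h0; rewrite e1 in h1; rewrite e2 in h2.
  have cE : j%:Z = i%:Z + c by rewrite /c; lia.
  exists c; have := st c; have := step_pred c st; rewrite /curv; first lia.
  by move=> ? ?; congr pair; lia.
case: (curv_cases c st) cv => [->//|[->//]|[_ p1 p2] _].
have := row (c + 1); have := col (c - 1) => q1 q2.
have e0 : (absz (X c + c)%R)%:Z - (absz (X c))%:Z = c by lia.
have e1 : (absz (X c + c)%R)%:Z - (absz (X c)).+1%:Z = c - 1 by lia.
have e2 : (absz (X c + c)%R).+1%:Z - (absz (X c))%:Z = c + 1 by lia.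
split; rewrite ?[_ \in _](mem _ _) ?e0 ?e1 ?e2; lia.
Qed.

Lemma addableP B :
  reflect (exists2 c : int, curv X c = 1 & B = abox c) (addable la B).
Proof.
have [mem row col] := rX; case: B => i j; rewrite addableE //=.
apply: (iffP and5P) => [[i0 j0 b0 b1 b2]|[c cv [-> ->]]].
  have := mem i j i0 j0; rewrite /= (negPf b0) => /esym h0.
  set c : int := j%:Z - i%:Z.
  have h1 : i%:Z - 1 <= X (c + 1).
    case/orP: b1 => [/eqP->|b1]; first by have := row (c + 1); lia.
    have i1 : (0 < i.-1)%N by move: b1; rewrite mem_boxes; lia.
    have := mem i.-1 j i1 j0; rewrite /= b1 => /esym.
    have -> : j%:Z - i.-1%:Z = c + 1 by rewrite /c; lia.
    lia.
  have h2 : i%:Z <= X (c - 1).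
    case/orP: b2 => [/eqP j1|b2]; first by have := col (c - 1); rewrite {2}/c; lia.
    have j1 : (0 < j.-1)%N by move: b2; rewrite mem_boxes; lia.
    have := mem i j.-1 i0 j1; rewrite /= b2 => /esym.
    by have -> : j.-1%:Z - i%:Z = c - 1 by rewrite /c; lia.
  rewrite -/c in h0.
  have cE : j%:Z = i%:Z + c by rewrite /c; lia.
  exists c; have := st c; have := step_pred c st; rewrite /curv; first lia.
  by move=> ? ?; congr pair; lia.
case: (curv_cases c st) cv => [->//|[_ p1 p2] _|[->//]].
have := row c; have := col c => q1 q2.
have e0 : (absz (X c + 1 + c)%R)%:Z - (absz (X c + 1)%R)%:Z = c by lia.
have e1 : (absz (X c + 1 + c)%R)%:Z - (absz (X c + 1)%R).-1%:Z = c + 1 by lia.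
have e2 : (absz (X c + 1 + c)%R).-1%:Z - (absz (X c + 1)%R)%:Z = c - 1 by lia.
split; try lia.
- by rewrite [_ \in _](mem _ _) ?e0; lia.
- have [//|ne] /= := eqVneq (absz (X c + 1)%R) 1%N.
  by rewrite [_ \in _](mem _ _) ?e1; lia.
- have [//|ne] /= := eqVneq (absz (X c + 1 + c)%R) 1%N.
  by rewrite [_ \in _](mem _ _) ?e2; lia.
Qed.

End Letters.

(** * Signatures and cancellation in terms of heights *)

Section Signature.

Variables (b : nat) (r : int) (la : seq nat) (X : int -> int) (N : nat).
Hypotheses (pl : is_partition la) (rX : represents (mem (boxes la)) X).
Hypothesis sX : supported N X.

Let st : profile_step X := represents_step (partition_downset pl) rX.

Definition in_residue (b : nat) (r c : int) : bool := (c %% b%:Z)%Z == r.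

Let cls := in_residue b r.

Definition letter_at (c : int) : letter :=
  if curv X c == -1 then (true, rbox X c) else (false, abox X c).

(** The signature obtained without sorting: the index [i] stands for the content [i - N], and
    stopping at [k] allows induction along the word. *)
Definition letters_upto (k : nat) : seq letter :=
  [seq letter_at (i%:Z - N%:Z) | i <- iota 0 k
    & cls (i%:Z - N%:Z) && (curv X (i%:Z - N%:Z) != 0)].

Lemma content_letter_at (c : int) : curv X c != 0 ->
  content (letter_at c).2 = c.
Proof.
have [mem row col] := rX; have := row c; have := col c => k0 r0.
rewrite /letter_at /content.
by case: (curv_cases c st) => [->//|[-> _ _]|[-> _ _]] _ /=; lia.
Qed.

Lemma mem_signature t : (t \in signature b r la) =
  (t \in letters_upto N.*2.+1).
Proof.
have [mem row col] := rX.
rewrite /signature mem_sort mem_filter mem_cat.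
set grid := [seq (i, j) | i <- _, j <- _].
have gridP x y : (x, y) \in grid =
    [&& 0 < x <= (size la).+1 & 0 < y <= (head 0 la).+1]%N.
  apply/allpairsPdep/andP => [[i [j [+ + [-> ->]]]]|[xP yP]].
    by rewrite !mem_iota => ? ?; split; lia.
  by exists x, y; rewrite !mem_iota; split=> //; lia.
move: grid gridP => grid gridP.
have inN (c : int) : curv X c != 0 -> - N%:Z <= c <= N%:Z.
  move=> nz; have [//|lt] := boolP (- N%:Z <= c <= N%:Z); case/eqP: nz.
  by apply: (supported_curv0 sX); lia.
apply/andP/mapP => [[rt /orP[|]] /mapP[B]|[i]].
- rewrite mem_filter => /andP[/(removableP pl rX)[c cv BE] _] tE.
  have nz : curv X c != 0 by rewrite cv.
  have lE : letter_at c = t by rewrite /letter_at cv eqxx -BE tE.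
  exists (absz (c + N%:Z)%R).
    rewrite mem_filter mem_iota; have := inN c nz => cN.
    have -> : (absz (c + N%:Z)%R)%:Z - N%:Z = c by lia.
    rewrite nz andbT; apply/andP; split; last lia.
    by rewrite /cls /in_residue -(content_letter_at nz) lE.
  by have := inN c nz => cN; have -> : (absz (c + N%:Z)%R)%:Z - N%:Z = c by lia.
- rewrite mem_filter => /andP[/(addableP pl rX)[c cv BE] _] tE.
  have nz : curv X c != 0 by rewrite cv.
  have lE : letter_at c = t by rewrite /letter_at cv -BE tE.
  exists (absz (c + N%:Z)%R).
    rewrite mem_filter mem_iota; have := inN c nz => cN.
    have -> : (absz (c + N%:Z)%R)%:Z - N%:Z = c by lia.
    rewrite nz andbT; apply/andP; split; last lia.
    by rewrite /cls /in_residue -(content_letter_at nz) lE.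
  by have := inN c nz => cN; have -> : (absz (c + N%:Z)%R)%:Z - N%:Z = c by lia.
set c := i%:Z - N%:Z; rewrite mem_filter => /andP[/andP[k nz] _] ->.
split; first by rewrite /residue content_letter_at.
rewrite /letter_at; apply/orP.
case: (curv_cases c st) nz => [->//|[cv p1 p2]|[cv p1 p2]] _; rewrite cv /=.
  right; apply/mapP; exists (abox X c) => //; rewrite mem_filter.
  have ad : addable la (abox X c) by apply/(addableP pl rX); exists c.
  rewrite ad /=; case E: (abox X c) ad => [x y]; rewrite addableE //= gridP.
  case/and5P=> x0 y0 _ o1 o2.
  have xs : (x <= (size la).+1)%N.
    by case/orP: o1 => [/eqP->//|/(box_bound pl)]; lia.
  have ys : (y <= (head 0 la).+1)%N.
    by case/orP: o2 => [/eqP->//|/(box_bound pl)]; lia.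
  lia.
left; apply/mapP; exists (rbox X c) => //; rewrite mem_filter.
have ad : removable la (rbox X c) by apply/(removableP pl rX); exists c.
rewrite ad /=; case E: (rbox X c) ad => [x y]; rewrite removableE //= gridP.
case/and3P=> bx _ _; have := box_bound pl bx.
by move: bx; rewrite mem_boxes; lia.
Qed.

(** Contents of letters are distinct within a signature, so both words are strictly sorted by
    content and determined by their members. *)
Lemma signature_letters : signature b r la = letters_upto N.*2.+1.
Proof.
pose lt (t u : letter) := content t.2 < content u.2.
apply: (irr_sorted_eq (leT := lt)).
- by move=> ? ? ?; apply: lt_trans.
- by move=> ?; apply: ltxx.
- have : sorted <%R [seq content t.2 | t <- signature b r la].
    rewrite lt_sorted_uniq_le sorted_map sort_sorted ?andbT; last first.
      by move=> t u; apply: le_total.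
    rewrite map_inj_in_uniq.
      rewrite sort_uniq filter_uniq //.
      set grid := [seq (i, j) | i <- _, j <- _].
      have ug : uniq grid.
        by apply: allpairs_uniq; rewrite ?iota_uniq // => -[? ?] [? ?].
      move: grid ug => grid ug.
      rewrite cat_uniq !map_inj_uniq ?filter_uniq ?andbT //=.
      - by apply/hasPn => t /mapP[B _ ->]; apply/mapP => -[].
      - by move=> ? ? [].
      - by move=> ? ? [].
    move=> t u; rewrite !mem_signature => /mapP[i + ->] /mapP[j + ->].
    rewrite !mem_filter => /andP[/andP[_ n1] _] /andP[/andP[_ n2] _].
    by rewrite !content_letter_at // => ->.
  by rewrite sorted_map.
- rewrite /letters_upto sorted_map.
  apply: (sub_in_sorted (P := fun i : nat => curv X (i%:Z - N%:Z) != 0)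
    (e := ltn)).
  + by move=> i j n1 n2 lt_ij; rewrite /relpre /lt /= !content_letter_at //; lia.
  + by apply/allP => i; rewrite mem_filter => /andP[/andP[]].
  + by apply: sorted_filter (iota_ltn_sorted _ _); apply: ltn_trans.
- exact: mem_signature.
Qed.

Variable h : int -> int.
Hypothesis hP : is_height cls X h.

(** Deleting RA leaves all A's before all R's, so the R's are on top of the stack. Their number is
    the drop of the height since its last maximum, located at the deepest R, which is the leftmost
    survivor [c0]. *)
Lemma good_stack (k : nat) : exists (rs : seq int) (as_ : seq letter),
  [/\ foldl (cancel_push true) [::] (letters_upto k) =
        [seq (true, rbox X c) | c <- rs] ++ as_,
      all (fun t : letter => ~~ t.1) as_
    & (rs = [::] /\ forall c : int, c <= k%:Z - N%:Z -> h c <= h (k%:Z - N%:Z)) \/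
      exists rs' c0, [/\ rs = rcons rs' c0, c0 < k%:Z - N%:Z,
        h (k%:Z - N%:Z) + (size rs)%:Z = h c0,
        (forall c : int, c <= c0 -> h c <= h c0)
      & (forall c : int, c0 < c <= k%:Z - N%:Z -> h c < h c0)]].
Proof.
elim: k => [|k [rs [as_ [E aA inv]]]].
  exists [::], [::]; split=> //; left; split=> // c cP.
  by rewrite !(height_left sX hP); lia.
have -> : letters_upto k.+1 = letters_upto k ++
    (if cls (k%:Z - N%:Z) && (curv X (k%:Z - N%:Z) != 0)
     then [:: letter_at (k%:Z - N%:Z)] else [::]).
  rewrite /letters_upto -[in iota 0 k.+1]addn1 iotaD filter_cat map_cat add0n /=.
  by case: ifP.
rewrite foldl_cat E; pose c : int := k%:Z - N%:Z; rewrite -/c.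
have cE : k.+1%:Z - N%:Z = c + 1 by rewrite /c; lia.
have hc := hP c; rewrite cE -/c in inv *.
have stay : h (c + 1) = h c -> exists (rs0 : seq int) (as_0 : seq letter),
    [/\ [seq (true, rbox X c) | c <- rs] ++ as_ =
        [seq (true, rbox X c) | c <- rs0] ++ as_0,
      all (fun t : letter => ~~ t.1) as_0
    & (rs0 = [::] /\ forall d : int, d <= c + 1 -> h d <= h (c + 1)) \/
      exists rs' c0, [/\ rs0 = rcons rs' c0, c0 < c + 1,
        h (c + 1) + (size rs0)%:Z = h c0,
        (forall d : int, d <= c0 -> h d <= h c0)
      & (forall d : int, c0 < d <= c + 1 -> h d < h c0)]].
  move=> hE; exists rs, as_; split=> //; case: inv => [[rs0 inv]|].
    left; split=> // d dP; have [->//|ne] := eqVneq d (c + 1).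
    by rewrite hE; apply: inv; lia.
  move=> [rs' [c0 [e1 e2 e3 e4 e5]]]; right; exists rs', c0.
  split=> //; try lia.
  move=> d dP; have [->//|ne] := eqVneq d (c + 1); last by apply: e5; lia.
  by rewrite hE -e3 e1 size_rcons; lia.
case k1: (cls c) hc => /= hc; last by apply: stay; rewrite hc addr0.
rewrite /letter_at; case: (curv_cases c st) hc => [->|[-> _ _]|[-> _ _]] hc /=.
- by apply: stay; rewrite hc addr0.
- case: rs E inv {stay} => [|c' rs] E inv /=.
    exists [::], ((false, abox X c) :: as_); split=> //=.
      by case: as_ aA {E} => //= t s /andP[/negPf -> _].
    left; split=> // d dP.
    case: inv => [[_ inv]|[rs' [c0 [+ _ _ _ _]]]]; last by case: rs'.
    have [->//|ne] := eqVneq d (c + 1).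
    by have := inv d; lia.
  exists rs, as_; split=> //; case: inv => [[//]|[rs' [c0 [e1 e2 e3 e4 e5]]]].
  have inc (d : int) : c0 < d <= c -> h d < h c0 by apply: e5.
  case: rs' e1 => [[cc rs0]|c'' rs' [cc rsE]].
    subst c' rs; left; split=> // d dP.
    have [->//|ne] := eqVneq d (c + 1).
    move: e3 => /= e3; have [l|l] := leP d c0; first by have := e4 d l; lia.
    by have := inc d; lia.
  right; exists rs', c0; split=> //; try lia.
    by move: e3; rewrite hc /=; lia.
  move=> d dP; have [->|ne] := eqVneq d (c + 1); last by apply: inc; lia.
  by move: e3; rewrite hc rsE /= size_rcons; lia.
exists (c :: rs), as_; split=> //=.
  case: rs E {inv stay} => [|c' rs] //= _.
  by case: as_ aA => //= t s /andP[/negPf -> _].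
right; case: inv => [[rsE inv]|[rs' [c0 [e1 e2 e3 e4 e5]]]].
  exists [::], c; subst rs; split=> //=; try lia.
  move=> d dP; have -> : d = c + 1 by lia.
  lia.
exists (c :: rs'), c0; rewrite e1; split=> //; try lia.
  by move: e3; rewrite e1 /= size_rcons hc; lia.
move=> d dP; have [->|ne] := eqVneq d (c + 1); last by apply: e5; lia.
by have := e5 c; lia.
Qed.

Lemma good_boxP (A : box) : is_good_box b r la A ->
  exists2 c0 : int, last_max h c0 & A = rbox X c0.
Proof.
rewrite /is_good_box /remaining_R /cancel_pairs signature_letters.
have [rs [as_ [-> aA inv]]] := good_stack N.*2.+1.
rewrite rev_cat filter_cat.
have -> : [seq t <- rev as_ | t.1] = [::].
  by apply/eqP; rewrite -(negbK (_ == _)) -has_filter has_rev -all_predC.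
have -> : [seq t <- rev [seq (true, rbox X c) | c <- rs] | t.1] =
    rev [seq (true, rbox X c) | c <- rs].
  by apply/all_filterP; rewrite all_rev; apply/allP => t /mapP[c _ ->].
case: inv => [[-> //]|[rs' [c0 [-> e2 _ e4 e5]]]].
rewrite map_rcons rev_rcons /= => -[<-]; exists c0 => //; split=> // c cP.
have [l|l] := leP c (N.*2.+1%:Z - N%:Z); first by apply: e5; lia.
rewrite (height_right sX hP); last lia.
by apply: e5; lia.
Qed.

(** Deleting AR leaves all R's before all A's, so the A's are on top. Their number is the rise of
    the height above its minimum, which is first reached right after the topmost R, the rightmost
    survivor [c1]. *)
Lemma cogood_stack (k : nat) : exists (rs : seq int) (as_ : seq letter),
  [/\ foldl (cancel_push false) [::] (letters_upto k) =
        as_ ++ [seq (true, rbox X c) | c <- rs],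
      all (fun t : letter => ~~ t.1) as_
    & (rs = [::] /\ forall c : int, c <= k%:Z - N%:Z ->
                      h (k%:Z - N%:Z) - (size as_)%:Z <= h c) \/
      exists c1 rs', [/\ rs = c1 :: rs', c1 < k%:Z - N%:Z,
        h (k%:Z - N%:Z) - (size as_)%:Z = h (c1 + 1),
        (forall c : int, c <= c1 -> h (c1 + 1) < h c)
      & (forall c : int, c1 < c <= k%:Z - N%:Z -> h (c1 + 1) <= h c)]].
Proof.
elim: k => [|k [rs [as_ [E aA inv]]]].
  exists [::], [::]; split=> //; left; split=> // c cP.
  by rewrite subr0 !(height_left sX hP); lia.
have -> : letters_upto k.+1 = letters_upto k ++
    (if cls (k%:Z - N%:Z) && (curv X (k%:Z - N%:Z) != 0)
     then [:: letter_at (k%:Z - N%:Z)] else [::]).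
  rewrite /letters_upto -[in iota 0 k.+1]addn1 iotaD filter_cat map_cat add0n /=.
  by case: ifP.
rewrite foldl_cat E; pose c : int := k%:Z - N%:Z; rewrite -/c.
have cE : k.+1%:Z - N%:Z = c + 1 by rewrite /c; lia.
have hc := hP c; rewrite cE -/c in inv *.
have upd (as_0 : seq letter) : all (fun t : letter => ~~ t.1) as_0 ->
    h (c + 1) - (size as_0)%:Z = h c - (size as_)%:Z -> 
    exists (rs0 : seq int) (as_1 : seq letter),
    [/\ as_0 ++ [seq (true, rbox X c) | c <- rs] =
        as_1 ++ [seq (true, rbox X c) | c <- rs0],
      all (fun t : letter => ~~ t.1) as_1
    & (rs0 = [::] /\ forall d : int, d <= c + 1 ->
                      h (c + 1) - (size as_1)%:Z <= h d) \/
      exists c1 rs', [/\ rs0 = c1 :: rs', c1 < c + 1,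
        h (c + 1) - (size as_1)%:Z = h (c1 + 1),
        (forall d : int, d <= c1 -> h (c1 + 1) < h d)
      & (forall d : int, c1 < d <= c + 1 -> h (c1 + 1) <= h d)]].
  move=> aA0 hE; exists rs, as_0; split=> //; case: inv => [[rs0 inv]|].
    left; split=> // d dP; have [->|ne] := eqVneq d (c + 1); first lia.
    by rewrite hE; apply: inv; lia.
  move=> [c1 [rs' [e1 e2 e3 e4 e5]]]; right; exists c1, rs'.
  split=> //; [lia|by rewrite hE|].
  move=> d dP; have [->|ne] := eqVneq d (c + 1); last by apply: e5; lia.
  by rewrite -e3 -hE; lia.
case k1: (cls c) hc => /= hc; last by apply: upd; rewrite ?hc ?addr0.
rewrite /letter_at; case: (curv_cases c st) hc => [->|[-> _ _]|[-> _ _]] hc /=.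
- by apply: upd; rewrite ?hc ?addr0.
- have := upd ((false, abox X c) :: as_); rewrite /= aA hc.
  have -> : cancel_push false (as_ ++ [seq (true, rbox X c) | c <- rs])
      (false, abox X c) =
    (false, abox X c) :: as_ ++ [seq (true, rbox X c) | c <- rs].
    by case: (as_ ++ _) => //= t s; rewrite andbF.
  by apply=> //; lia.
- case: as_ E aA inv upd => [|t as_] E aA inv upd /=.
    have -> : cancel_push false [seq (true, rbox X c) | c <- rs]
      (true, rbox X c) = (true, rbox X c) :: [seq (true, rbox X c) | c <- rs].
      by case: (rs).
    exists (c :: rs), [::]; split=> //; right; exists c, rs; split=> //=.
    + lia.
    + by rewrite subr0.
    + case: inv => [[_ inv] d dP|[c1 [rs' [e1 e2 /= e3 e4 e5]]] d dP].
        by have /= := inv d; rewrite hc; lia.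
      rewrite hc; have [l|l] := leP d c1; first by have := e4 d l; lia.
      by have := e5 d; lia.
    + move=> d dP; have -> : d = c + 1 by lia.
      exact: lexx.
  move: aA => /= /andP[/negPf t1 aA]; rewrite t1 /=.
  by apply: upd => //=; rewrite hc; lia.
Qed.

Lemma cogood_boxP (A : box) : is_cogood_box b r la A ->
  exists2 c1 : int, first_min h c1 & A = rbox X c1.
Proof.
rewrite /is_cogood_box /remaining_R /cancel_pairs signature_letters.
have [rs [as_ [-> aA inv]]] := cogood_stack N.*2.+1.
rewrite -map_rev -filter_rev revK filter_cat.
have -> : [seq t <- as_ | t.1] = [::].
  by apply/eqP; rewrite -(negbK (_ == _)) -has_filter -all_predC.
have -> : [seq t <- [seq (true, rbox X c) | c <- rs] | t.1] =
    [seq (true, rbox X c) | c <- rs].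
  by apply/all_filterP; apply/allP => t /mapP[c _ ->].
case: inv => [[-> //]|[c1 [rs' [-> e2 e3 e4 e5]]]].
move=> /= -[<-]; exists c1 => //; split=> // c cP.
have [l|l] := leP c (N.*2.+1%:Z - N%:Z); first by apply: e5; lia.
rewrite [h c](height_right sX hP) //; last lia.
by apply: e5; lia.
Qed.

End Signature.

(** * Following a run of the Mullineux procedure *)

Lemma height_exists N X cls : supported N X -> exists h, is_height cls X h.
Proof.
move=> sX; pose g (c : int) := if cls c then curv X c else 0.
exists (fun c => \sum_(i < absz (Num.max 0 (c + N%:Z))) g (i%:Z - N%:Z)) => c.
have [ge|lt] := leP (- N%:Z) c.
  have -> : absz (Num.max 0 (c + 1 + N%:Z)) = (absz (Num.max 0 (c + N%:Z))).+1.
    lia.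
  rewrite big_ord_recr /=; congr (_ + _).
  by have -> : (absz (Num.max 0 (c + N%:Z)))%:Z - N%:Z = c by lia.
have -> : absz (Num.max 0 (c + 1 + N%:Z)) = 0%N by lia.
have -> : absz (Num.max 0 (c + N%:Z)) = 0%N by lia.
by rewrite !big_ord0 (supported_curv0 sX) ?if_same //; lia.
Qed.

Lemma in_residue_class (b : nat) (r : int) :
  residue_class b%:Z (in_residue b r).
Proof.
move=> c c' /eqP <-; rewrite /in_residue eqz_mod_dvd.
by [].
Qed.

Lemma represents_lower D X (c0 : int) : represents D X ->
  X (c0 - 1) = X c0 -> X (c0 + 1) = X c0 - 1 ->
  represents (fun B => (B != rbox X c0) && D B) (lower X c0).
Proof.
move=> [mem row col] r1 r2; have k1 := col (c0 - 1); have k2 := row (c0 + 1).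
split.
- move=> x y x0 y0; rewrite mem // /lower /rbox xpair_eqE.
  have [E|ne] := eqVneq (y%:Z - x%:Z) c0; last by case: leP => l; lia.
  by rewrite E; lia.
- by move=> c; rewrite /lower; case: eqP => [->|_]; [lia|exact: row].
- by move=> c; rewrite /lower; case: eqP => [->|_]; [lia|exact: col].
Qed.

Lemma represents_ext D E X Y : D =1 E -> X =1 Y -> represents D X ->
  represents E Y.
Proof.
move=> DE XY [mem row col]; split=> *; rewrite -?DE -?XY; auto.
Qed.

(** The empty profile lies below [Z], so each ladder sum has terms of one sign and all of them
    vanish; the ladder through the vertex of [Z] at [c] then forces equality at [c]. *)
Lemma matched_nil (a b : int) N X Z : 0 < b ->
  represents (mem (boxes [::])) X -> supported N X -> supported N Z ->
  (forall c : int, 0 <= Z c) -> (forall c : int, 0 <= Z c + c) ->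
  matched a b N X Z -> X =1 Z.
Proof.
move=> b0 [mem row col] sX sZ rZ kZ mXZ.
have XE (c : int) : X c = Num.max 0 (- c).
  have := row c; have := col c => k r.
  have [//|ne] := eqVneq (X c) (Num.max 0 (- c)).
  have := mem (absz (X c)) (absz (X c + c)%R); rewrite /= mem_boxes nth_nil.
  have -> : (absz (X c + c)%R)%:Z - (absz (X c))%:Z = c by lia.
  lia.
have le (c : int) : X c <= Z c by have := rZ c; have := kZ c; rewrite XE; lia.
have vle (c : int) : vindex a b X c <= vindex a b Z c.
  by rewrite lerD2r ler_pM2l.
move=> c; apply/eqP; rewrite eq_le le /=.
have [cN|cN] := boolP ((c <= - N%:Z) || (N%:Z <= c)).
  case/orP: cN => cN; first by rewrite (proj2 (sX c)) // (proj2 (sZ c)).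
  by rewrite (proj1 (sX c)) // (proj1 (sZ c)).
pose e := vindex a b Z c.
have := mXZ e; rewrite /range_sum => s0.
have s0' : \sum_(i < N.*2.+1) - ladder_diff a b X Z e (i%:Z - N%:Z) = 0.
  by rewrite sumrN s0 oppr0.
have pos (i : 'I_N.*2.+1) : true ->
    0 <= - ladder_diff a b X Z e (i%:Z - N%:Z).
  move=> _; rewrite /ladder_diff; case: ifP => // _.
  have := fun l => le_trans (x := e) l (vle (i%:Z - N%:Z)).
  by case: (e <= vindex a b X _); case: (e <= _) => // /(_ isT).
have := psumr_eq0P pos s0'.
move/(_ (inord (absz (c + N%:Z)%R)) isT); rewrite inordK; last lia.
have -> : (absz (c + N%:Z)%R)%:Z - N%:Z = c by lia.
rewrite /ladder_diff {1}/e /vindex addrK dvdz_mulr // -/(vindex a b Z c) -/e lexx.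
case: leP => // l _; move: l.
by rewrite /e /vindex lerD2r ler_pM2l.
Qed.

(* Along any run the profile of the partition that remains to be treated stays
   matched with a profile obtained from Z by removing co-good boxes. *)
Lemma mullineux_run (a b N : nat) la mu : (0 < a)%N -> (a < b)%N ->
  coprime a b -> mullineux_tr b la mu ->
  forall X Z, is_partition la -> represents (mem (boxes la)) X ->
    admissible a b X -> admissible (b%:Z - a%:Z) b (tr Z) ->
    supported N X -> supported N Z -> matched a b N X Z ->
  [/\ is_partition mu, represents (mem (boxes mu)) Z
    & size (boxes mu) = size (boxes la)].
Proof.
move=> a0 ab cop; elim=> [|r {}la {}mu A B gA _ IH adB coB] X Z pl rX admX admZ
  sX sZ mXZ.
  split=> //; apply: (represents_ext _ _ rX) => //.
  apply: matched_nil sX sZ _ _ mXZ => //; first lia.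
    by move=> c; have := adm_col admZ (- c); rewrite /tr opprK; lia.
  by move=> c; have := adm_row admZ (- c); rewrite /tr opprK; lia.
have a0' : 0 < a%:Z by lia.
have ab' : a%:Z < b%:Z by lia.
have copz : coprimez a%:Z b%:Z by [].
have cP := @in_residue_class b r.
have [hX hXP] := height_exists (in_residue b r) sX.
have [hZ hZP] := height_exists (in_residue b r) sZ.
have [c0 lm AE] := good_boxP pl rX sX hXP gA.
have [k0 r1 r2] := last_max_removable a0' ab' admX hXP lm.
have rA : removable la A.
  by apply/(removableP pl rX); exists c0; rewrite // /curv r1 r2; lia.
have [pl' bl'] := mem_del_box pl rA.
have rX' : represents (mem (boxes (del_box la A))) (lower X c0).
  apply: represents_ext (represents_lower rX r1 r2) => // -[x y].
  by rewrite -AE /= bl'.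
have [c1 [fm k1 admZ' [sX' sZ'] mXZ']] :=
  cogood_match a0' ab' copz admX admZ sX sZ mXZ cP hXP hZP lm.
have admX' := lower_admissible a0' ab' admX cP hXP lm.
have [pm rm sz] := IH _ _ pl' rX' admX' admZ' sX' sZ' mXZ'.
have [pm' bm'] := mem_add_box adB.
have BN : B \notin boxes mu by move: adB; rewrite addableE // => /and5P[].
have szE : size (boxes (add_box mu B)) = size (boxes la).
  have AL : A \in boxes la by case/and3P: rA.
  rewrite (size_add_uniq (boxes_uniq mu) (boxes_uniq _) BN) => [|[x y]];
    last exact: bm'.
  rewrite sz -(@size_add_uniq _ (boxes la) A) ?boxes_uniq // => [|[x y]].
    by case: (A) bl' => x y bl'; rewrite bl' eqxx.
  by rewrite bl'; case: eqP => // ->.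
split=> //.
have dm' := partition_downset pm'.
have rW := profile_represents dm' (partition_bounded pm').
set W := profile _ _ in rW.
have sW := represents_supported dm' (partition_bounded pm') rW.
have stW := represents_step dm' rW.
have stZ : profile_step Z by apply/profile_step_tr/(adm_step admZ).
have [hW hWP] := height_exists (in_residue b r) sW.
have [c2 fm2 BE] := cogood_boxP pm' rW sW hWP coB.
have [k2 [s1 s2]] : in_residue b r c2 /\ W (c2 - 1) = W c2 /\ W (c2 + 1) = W c2 - 1.
  have := proj1 fm2 c2 (lexx _); rewrite hWP.
  case: (in_residue b r c2); last by rewrite addr0 ltxx.
  by case: (curv_cases c2 stW) => [->|[-> _ _]|[_ -> ->]] //;
    rewrite ?addr0 ?ltxx // gtrDl.
have rW' := represents_lower rW s1 s2.
(* [W] comes from the run and [Z] from the prediction. Without their co-good boxes both represent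
   [mu], so uniqueness of the first minimum gives [c1 = c2], hence [W = Z]. *)
have E : lower Z c1 =1 lower W c2.
  apply: represents_eq rm rW' _ => x y x0 y0.
  by rewrite -BE /= bm'; case: eqP => [->|] //=; apply/negbTE.
have c12 := first_min_unique _ cP stZ stW hZP hWP k1 k2 fm fm2 E.
apply: represents_ext rW => // c; have := E c.
by rewrite c12 ?ltz_nat ?(leq_ltn_trans a0) // /lower; case: eqP => _ => [/addIr|] ->.
Qed.

Local Open Scope nat_scope.

(** * Triangular diagrams *)

(* The boxes of D come first when boxes are ordered by the linear form
   [ladder_index a b], ties being broken by decreasing content ([tri_left]) or
   increasing content ([tri_right]): the form is a limit of generic ones of
   slope slightly below, resp. above, a/b. *)
Definition tri_left (a b : nat) (D : pred box) : Prop :=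
  forall x y x' y', D (x, y) -> 0 < x' -> 0 < y' -> ~~ D (x', y') ->
    ladder_index a b (x, y) < ladder_index a b (x', y') \/
    ladder_index a b (x, y) = ladder_index a b (x', y') /\ y' + x < y + x'.

Definition tri_right (a b : nat) (D : pred box) : Prop :=
  forall x y x' y', D (x, y) -> 0 < x' -> 0 < y' -> ~~ D (x', y') ->
    ladder_index a b (x, y) < ladder_index a b (x', y') \/
    ladder_index a b (x, y) = ladder_index a b (x', y') /\ y + x' < y' + x.

Definition tr_set (D : pred box) : pred box := fun B => D (B.2, B.1).

Lemma ladder_index_le a b x y x' y' : x' <= x -> y' <= y ->
  ladder_index a b (x', y') <= ladder_index a b (x, y).
Proof. by move=> lx ly; rewrite /ladder_index leq_add // leq_mul. Qed.

Lemma ladder_index_tr a b x y : a <= b ->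
  ladder_index (b - a) b (y, x) = ladder_index a b (x, y).
Proof. by move=> ab; rewrite /ladder_index /= subKn // addnC. Qed.

Lemma tri_right_tr a b D : a <= b -> tri_right a b D ->
  tri_left (b - a) b (tr_set D).
Proof.
move=> ab tri x y x' y'; rewrite /tr_set /= => Dxy x0 y0 nD.
rewrite !ladder_index_tr //; have [lt|[E lt]] := tri _ _ _ _ Dxy y0 x0 nD.
  by left.
by right; split=> //; lia.
Qed.

Lemma tri_left_downset a b D : 0 < a < b -> positive D -> tri_left a b D ->
  downset D.
Proof.
move=> /andP[a0 ab] pD tri; split=> // x y x' y' xP yP Dxy.
apply/negPn/negP => nD.
have [x'0 y'0] : 0 < x' /\ 0 < y' by lia.
have [|] := tri _ _ _ _ Dxy x'0 y'0 nD.
  by rewrite ltnNge ladder_index_le //; lia.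
rewrite /ladder_index /=; have [e1|n1] := eqVneq x x'; nia.
Qed.

Lemma downset_tr D : downset (tr_set D) <-> downset D.
Proof.
split=> -[p d]; split=> x y; rewrite /tr_set /=.
- by move/(p y x); lia.
- by move=> x' y' ? ? H; apply: (d y x y' x').
- by move/(p y x); lia.
- by move=> x' y' ? ? H; apply: (d y x y' x').
Qed.

Lemma tri_right_downset a b D : 0 < a < b -> positive D -> tri_right a b D ->
  downset D.
Proof.
move=> /andP[a0 ab] pD tri; apply/downset_tr.
apply: (@tri_left_downset (b - a) b); first lia.
  by move=> x y /pD[].
by apply: tri_right_tr => //; lia.
Qed.

Lemma represents_tr D X : represents D X -> represents (tr_set D) (tr X).
Proof.
move=> [mem row col]; split=> [x y x0 y0|c|c]; rewrite /tr.
- by rewrite /tr_set /= mem // opprB -lerBlDr subKr.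
- by have := col (- c)%R; lia.
- by have := row (- c)%R; lia.
Qed.

Lemma vindex_ladder (a b : nat) X (c : int) (x y : nat) : a <= b ->
  x%:Z = X c -> y%:Z = (X c + c)%R ->
  (ladder_index a b (x, y))%:Z = vindex a b X c.
Proof.
move=> ab xE yE; rewrite /ladder_index /vindex /= -xE.
have -> : c = (y%:Z - x%:Z)%R by lia.
rewrite PoszD !PoszM -subzn //; lia.
Qed.

(** Both inequalities compare one box inside with one outside. For the packing these are the last
    box of content [c] and the first missing one of content [c']; for the hook, the foot of its
    column and the point just right of its row. [tri_left] excludes ties since [c < c'], and
    divisibility supplies the gap [b]. *)
Lemma tri_left_admissible (a b : nat) D X : 0 < a < b -> downset D ->
  represents D X -> tri_left a b D -> admissible a b X.
Proof.
move=> /andP[a0 ab] dD rX tri.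
have st := represents_step dD rX; have [mem row col] := rX.
have inD (c : int) (x y : nat) : 0 < x -> 0 < y -> c = (y%:Z - x%:Z)%R ->
    D (x, y) = (x%:Z <= X c)%R.
  by move=> x0 y0 ->; apply: mem.
have [b0 bZ] : 0 < b /\ (0 < b%:Z)%R by lia.
split=> // c c' lt dv.
- move=> pos; have := row c => r0; have := row c' => r0'; have := col c' => k0.
  (* If [X c = 0] there is no box of content [c] to compare with; the index is then [a * c] and
     monotonicity in [c] suffices. *)
  have [x1|x1] : X c = 0%R \/ (0 < X c)%R by lia.
    rewrite /vindex x1 mulr0 add0r.
    have : (0 <= b%:Z * X c')%R by apply: mulr_ge0.
    by nia.
  rewrite leNgt; apply/negP => lt'.
  have dvi := vindex_dvd a X dv.
  have ge : (vindex a b X c' + b%:Z <= vindex a b X c)%R.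
    have := @dvdz_step b%:Z (vindex a b X c - vindex a b X c')%R bZ.
    rewrite -[X in (_ %| X)%Z]opprB rpredN dvi; lia.
  have D1 : D (absz (X c), absz (X c + c)%R).
    by rewrite (inD c); lia.
  have D2 : ~~ D (absz (X c' + 1)%R, absz (X c' + 1 + c')%R).
    by rewrite (inD c'); lia.
  have i1 := @vindex_ladder a b X c (absz (X c)) (absz (X c + c)%R).
  have i2 : (ladder_index a b (absz (X c' + 1)%R, absz (X c' + 1 + c')%R))%:Z =
      (vindex a b X c' + b%:Z)%R.
    rewrite (@vindex_ladder a b (fun c => X c + 1)%R c'); try lia.
    by rewrite /vindex; lia.
  have := tri _ _ _ _ D1 _ _ D2; lia.
- move=> g1 g2; have := row c => r0; have := row c' => r0'; have := col c => k0.
  have := row (c' + 1)%R => r1.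
  have mono (k : nat) : (X (c + k%:Z) <= X c)%R.
    elim: k => [|k IH]; first by rewrite addr0.
    have -> : (c + k.+1%:Z = c + k%:Z + 1)%R by lia.
    by have := st (c + k%:Z)%R; lia.
  have x1 : (0 < X c)%R.
    have := mono (absz (c' - c)%R).
    have -> : (c + (absz (c' - c))%:Z = c')%R by lia.
    lia.
  have D1 : D (absz (X c), absz (X c + c + 1)%R).
    by rewrite (inD (c + 1)%R); lia.
  have kc' : (0 <= X c' + c')%R := col c'.
  have D2 : ~~ D (absz (X c'), absz (X c' + c' + 1)%R).
    by rewrite (inD (c' + 1)%R); lia.
  have i1 : (ladder_index a b (absz (X c), absz (X c + c + 1)%R))%:Z =
      (vindex a b X c + a%:Z)%R.
    rewrite (@vindex_ladder a b X (c + 1)%R); try lia.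
    by rewrite /vindex; lia.
  have i2 : (ladder_index a b (absz (X c'), absz (X c' + c' + 1)%R))%:Z =
      (vindex a b X c' + a%:Z)%R.
    rewrite (@vindex_ladder a b (fun d => X d + 1)%R (c' + 1)%R); try lia.
    by rewrite /vindex g2; lia.
  have := @dvdz_step b%:Z (vindex a b X c' - vindex a b X c)%R bZ.
  rewrite vindex_dvd //.
  have := tri _ _ _ _ D1 _ _ D2; lia.
Qed.

(** * Counting boxes on ladders, and column regularization *)

Lemma mem_ladder a b c x y : 0 < a < b -> ((x, y) \in ladder a b c) =
  [&& 0 < x, 0 < y & ladder_index a b (x, y) == c].
Proof.
move=> /andP[a0 ab]; rewrite mem_filter.
apply/andP/and3P => [[E /allpairsPdep[i [j [+ + [xi yj]]]]]|[x0 y0 E]].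
  by rewrite mem_rev !mem_iota xi yj in E * => ? ?; split=> //; lia.
split=> //; apply/allpairsPdep; exists x, y.
move/eqP: E; rewrite /ladder_index /= => E.
by rewrite mem_rev !mem_iota; split=> //; nia.
Qed.

Lemma ladder_uniq a b c : uniq (ladder a b c).
Proof.
by rewrite filter_uniq // allpairs_uniq ?rev_uniq ?iota_uniq // => -[? ?] [].
Qed.

(** [t] is the row of the point of content [c] on the ladder [e]. A ladder meets each diagonal at
    most once, so its boxes can be counted by content. *)
Definition ladder_hit (a b : nat) (D : pred box) (e c : int) : bool :=
  let t := ((e - a%:Z * c)%R %/ b%:Z)%Z in
  [&& (b%:Z %| (e - a%:Z * c)%R)%Z, (0 < t)%R, (0 < t + c)%R
    & D (absz t, absz (t + c)%R)].

Lemma ladder_hitP (a b : nat) D (e c : int) : 0 < b ->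
  ladder_hit a b D e c <->
  exists x y : nat, [/\ 0 < x, 0 < y, D (x, y), c = (y%:Z - x%:Z)%R
    & e = (b%:Z * x%:Z + a%:Z * c)%R].
Proof.
move=> b0; rewrite /ladder_hit; split.
  case/and4P=> /dvdzP[q qE]; rewrite qE mulzK; last lia.
  move=> q0 c0 Dq; exists (absz q), (absz (q + c)%R); split=> //; lia.
case=> x [y [x0 y0 Dxy cE eE]].
have -> : (e - a%:Z * c = x%:Z * b%:Z)%R by lia.
rewrite mulzK; last lia.
rewrite dvdz_mull // cE; have -> : (x%:Z + (y%:Z - x%:Z) = y%:Z)%R by lia.
by apply/and4P; split=> //; lia.
Qed.

Lemma range_sum_count N (p : int -> bool) :
  range_sum N (fun c => if p c then 1 else 0)%R =
  (count (fun i : nat => p (i%:Z - N%:Z)%R) (iota 0 N.*2.+1))%:Z.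
Proof.
rewrite /range_sum; elim: (N.*2.+1) => [|k IH]; first by rewrite big_ord0.
have -> : iota 0 k.+1 = iota 0 k ++ [:: k] by rewrite -addn1 iotaD.
rewrite big_ord_recr IH count_cat PoszD /= addn0.
by case: (p _).
Qed.

Lemma count_ladder (a b N : nat) D (e : nat) : 0 < a < b -> positive D ->
  bounded N D -> (count D (ladder a b e))%:Z =
    range_sum N (fun c => if ladder_hit a b D e%:Z c then 1 else 0)%R.
Proof.
move=> abP pD bd; rewrite range_sum_count; congr Posz.
pose t (i : nat) := ((e%:Z - a%:Z * (i%:Z - N%:Z))%R %/ b%:Z)%Z.
pose f (i : nat) : box := (absz (t i), absz (t i + (i%:Z - N%:Z))%R).
rewrite -!size_filter; set s := [seq i <- iota _ _ | _].
rewrite -(size_map f s); apply/perm_size/uniq_perm.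
- exact/filter_uniq/ladder_uniq.
- rewrite map_inj_in_uniq ?filter_uniq ?iota_uniq // => i j.
  rewrite !mem_filter => /andP[/and4P[_ i1 i2 _] _] /andP[/and4P[_ j1 j2 _] _].
  rewrite /f => -[]; rewrite -/(t i) -/(t j) in i1 i2 j1 j2 *; lia.
case=> x y; rewrite mem_filter mem_ladder //.
apply/idP/mapP => [/and4P[Dxy x0 y0 /eqP eE]|[i]].
  have [xN yN] := bd _ _ Dxy; exists (y + N - x).
    rewrite mem_filter mem_iota; apply/andP; split; last lia.
    apply/ladder_hitP; first lia.
    exists x, y; split=> //; first lia.
    rewrite -eE /ladder_index PoszD !PoszM -subzn /=; lia.
  have tE : t (y + N - x) = x%:Z.
    rewrite /t; have -> : (e%:Z - a%:Z * ((y + N - x)%:Z - N%:Z) = x%:Z * b%:Z)%R.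
      by rewrite -eE /ladder_index PoszD !PoszM -!subzn /=; lia.
    by rewrite mulzK //; lia.
  by rewrite /f tE; congr pair; lia.
rewrite mem_filter => /andP[/and4P[d i1 i2 Di] _] [-> ->].
rewrite /f -/(t i) in d i1 i2 Di *; rewrite Di /=.
have eE : (e%:Z = b%:Z * t i + a%:Z * (i%:Z - N%:Z))%R.
  by have := divzK d; rewrite -/(t i); lia.
apply/and3P; split; [lia|lia|apply/eqP].
apply/eqP; rewrite -eqz_nat eE /ladder_index PoszD !PoszM -subzn /=; last lia.
by apply/eqP; lia.
Qed.

Lemma matched_count (a b N : nat) D E X Z : 0 < a < b ->
  positive D -> positive E -> bounded N D -> bounded N E ->
  represents D X -> represents E Z ->
  (forall c, count D (ladder a b c) = count E (ladder a b c)) ->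
  matched a b N X Z.
Proof.
move=> abP pD pE bD bE rX rZ cDE e.
have b0 : 0 < b by lia.
transitivity (range_sum N (fun c =>
    (if ladder_hit a b D e c then 1 else 0) -
    (if ladder_hit a b E e c then 1 else 0))%R).
  apply: eq_range_sum => c _; rewrite /ladder_diff /ladder_hit.
  case: (boolP (_ %| _)%Z) => // dv; set t := (_ %/ _)%Z; rewrite /=.
  have eE : e = (b%:Z * t + a%:Z * c)%R by have := divzK dv; rewrite -/t; lia.
  have vE Y : (e <= vindex a b Y c)%R = (t <= Y c)%R.
    by rewrite eE /vindex lerD2r ler_pM2l //; lia.
  rewrite !vE.
  have [t0|t0] := ltP 0%R t; last first.
    by rewrite (le_trans t0 (repr_row rX c)) (le_trans t0 (repr_row rZ c)).
  have [tc|tc] := ltP 0%R (t + c)%R; last first.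
    have -> : (t <= X c)%R by have := repr_col rX c; lia.
    by have -> : (t <= Z c)%R by have := repr_col rZ c; lia.
  rewrite !(repr_mem rX, repr_mem rZ) /=; try lia.
  have -> : ((absz (t + c))%:Z - (absz t)%:Z = c)%R by lia.
  by have -> : (absz t)%:Z = t by lia.
rewrite range_sumB.
case: e => [e|e]; first by rewrite -!count_ladder // cDE subrr.
(* [matched] ranges over all integers, [ladder] over naturals only; a negative index is not taken in
   the positive quadrant. *)
have no F c : ladder_hit a b F (Negz e) c = false.
  apply/negP => /ladder_hitP-/(_ b0)[x [y [x0 y0 _ cE]]].
  have : (0 <= (b%:Z - a%:Z) * x%:Z)%R by apply: mulr_ge0; lia.
  have : (0 <= a%:Z * y%:Z)%R by [].
  by rewrite cE; lia.
have sum0 G : range_sum N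
    (fun c => if ladder_hit a b G (Negz e) c then 1 else 0)%R = 0%R.
  by rewrite /range_sum big1 // => i _; rewrite no.
by rewrite !sum0 subrr.
Qed.

Lemma pairwise_allpairs (s t : seq nat) : pairwise geq s ->
  pairwise (fun P Q : box => Q.1 <= P.1) [seq (x, y) | x <- s, y <- t].
Proof.
elim: s => //= x s IH /andP[/allP xs ps]; rewrite pairwise_cat IH // andbT.
apply/andP; split.
  apply/allrelP => P Q /mapP[y _ ->] /allpairsPdep[x' [y' [x's _ ->]]] /=.
  exact: xs.
by elim: {IH} t => //= y t ->; rewrite andbT; apply/allP => P /mapP[? _ ->].
Qed.

Lemma ladder_take_lt a b c k (P Q : box) : 0 < a < b ->
  P \in take k (ladder a b c) -> Q \in drop k (ladder a b c) -> Q.1 < P.1.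
Proof.
move=> abP Pt Qd; have le : Q.1 <= P.1.
  have : pairwise (fun P Q : box => Q.1 <= P.1) (ladder a b c).
    apply: pairwise_filter; apply: pairwise_allpairs.
    rewrite -sorted_pairwise; last by move=> ? ? ? /= h1 h2; exact: leq_trans h2 h1.
    rewrite rev_sorted; exact: iota_sorted.
  by rewrite -{1}(cat_take_drop k (ladder a b c)) pairwise_cat =>
    /andP[/allrelP/(_ _ _ Pt Qd)].
rewrite ltn_neqAle le andbT; apply/eqP => E.
have := ladder_uniq a b c; rewrite -(cat_take_drop k (ladder a b c)) cat_uniq.
case/and3P=> _ /hasP[]; exists Q => //.
suff -> : Q = P by [].
have := mem_take Pt; have := mem_drop Qd.
case: P Q E {Pt Qd le} => [x y] [x' y'] /= <-; rewrite !mem_ladder //.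
move=> /and3P[_ _ /eqP e1] /and3P[_ _ /eqP e2]; congr pair.
by move: e1; rewrite -e2 /ladder_index /=; nia.
Qed.

Section ColumnReg.

Variables (a b : nat) (D : {fset box}).
Hypothesis abP : 0 < a < b.

Local Notation L := (ladder a b).
Local Notation k := (fun c => count (mem D) (L c)).
Local Notation E := (column_reg a b D).

Lemma mem_column_reg P :
  (P \in E) = (P \in take (k (ladder_index a b P)) (L (ladder_index a b P))).
Proof.
rewrite /column_reg inE /=; apply/flatten_mapP/idP => [[c _ Pc]|PL].
  have := mem_take Pc; case: P Pc => x y Pc.
  by rewrite mem_ladder // => /and3P[_ _ /eqP ->].
exists (ladder_index a b P) => //.
have : has (mem D) (L (ladder_index a b P)).
  by rewrite has_count; case: (k _) PL; rewrite ?take0.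
case/hasP=> -[x y]; rewrite mem_ladder // => /and3P[_ _ /eqP <-] Dxy.
by apply: map_f.
Qed.

Lemma column_reg_positive : positive (mem E).
Proof.
move=> x y; rewrite /= mem_column_reg => /mem_take.
by rewrite mem_ladder // => /and3P[].
Qed.

Lemma count_column_reg c : count (mem E) (L c) = count (mem D) (L c).
Proof.
rewrite -{1}(cat_take_drop (k c) (L c)) count_cat.
have inE' P : P \in L c -> (P \in E) = (P \in take (k c) (L c)).
  by case: P => x y; rewrite mem_column_reg mem_ladder // => /and3P[_ _ /eqP->].
have := ladder_uniq a b c; rewrite -{1}(cat_take_drop (k c) (L c)) cat_uniq.
case/and3P=> _ /hasPn nt _.
have -> : count (mem E) (take (k c) (L c)) = k c.
  rewrite -[RHS](@size_takel (k c) _ (L c)) ?count_size //.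
  by apply/eqP; rewrite -all_count; apply/allP => P Pt /=;
     rewrite inE' ?(mem_take Pt).
have -> : count (mem E) (drop (k c) (L c)) = 0.
  by apply/eqP; rewrite -leqn0 leqNgt -has_count; apply/hasPn => P Pd /=;
     rewrite inE' ?(mem_drop Pd) // nt.
by rewrite addn0.
Qed.

(** A ladder that meets the new diagram met the old one, and a ladder with a point outside the new
    diagram had one outside the old. So the order between ladders is inherited, and only the tie
    rule on one ladder is reversed. *)
Lemma column_reg_tri : tri_left a b (mem D) -> tri_right a b (mem E).
Proof.
move=> tri x y x' y' /= PE x'0 y'0 QE.
set P := (x, y) in PE *; set Q := (x', y') in QE *.
have QL : Q \in L (ladder_index a b Q) by rewrite mem_ladder ?x'0 ?y'0 /=.
rewrite mem_column_reg in PE; rewrite mem_column_reg in QE.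
have [P1 P1L DP1] : exists2 P1, P1 \in L (ladder_index a b P) & P1 \in D.
  by apply/hasP; rewrite has_count; case: (k _) PE; rewrite ?take0.
have [Q1 Q1L DQ1] : exists2 Q1, Q1 \in L (ladder_index a b Q) & Q1 \notin D.
  apply/hasP; rewrite has_predC; apply: contra QE; rewrite all_count => /eqP kE.
  by rewrite kE take_size.
case: P1 P1L DP1 => x1 y1; rewrite mem_ladder // => /and3P[_ _ /eqP e1] DP1.
case: Q1 Q1L DQ1 => x2 y2; rewrite mem_ladder // => /and3P[x20 y20 /eqP e2] DQ1.
have : ladder_index a b P <= ladder_index a b Q.
  rewrite -e1 -e2.
  by have [/ltnW//|[-> _]] := tri _ _ _ _ DP1 x20 y20 DQ1.
rewrite leq_eqVlt => /orP[/eqP eq|lt]; last by left.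
right; split=> //; rewrite -eq in QL QE.
have lt : Q.1 < P.1.
  apply: ladder_take_lt abP PE _; move: QL.
  by rewrite -{1}(cat_take_drop (k (ladder_index a b P)) (L _)) mem_cat
    (negPf QE).
by move: eq lt; rewrite /ladder_index /P /Q /=; nia.
Qed.

End ColumnReg.

(** * Crossing one wall *)

Lemma bounded_fset (E : {fset box}) : exists N, bounded N (mem E).
Proof.
pose N := \max_(P <- E) (P.1 + P.2).
exists N => x y /= PE; suff : x + y <= N by lia.
by apply: (bigmaxn_sup_seq (x, y)).
Qed.

Lemma mem_diagram la B : (B \in diagram la) = (B \in boxes la).
Proof. by rewrite inE. Qed.

Lemma diagram_positive la : positive (mem (diagram la)).
Proof. by move=> x y /=; rewrite mem_diagram mem_boxes => /and3P[]. Qed.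

Lemma nth_count_gt la x i : is_partition la ->
  (x < nth 0 la i) = (i < count (fun z => x < z) la).
Proof.
case/andP=> + _; elim: la i => [|y s IH] i /= px; first by rewrite nth_nil.
have ys : all (geq y) s.
  by apply: order_path_min px => ? ? ? /= h1 h2; exact: leq_trans h2 h1.
have [xy|yx] := ltnP x y.
  by case: i => [|i] /=; rewrite ?xy // IH // (path_sorted px).
have -> : count (fun z => x < z) s = 0.
  apply/eqP; rewrite -leqn0 leqNgt -has_count; apply/hasPn => z /(allP ys) /=.
  lia.
apply/negbTE; rewrite -leqNgt.
have [lt|ge] := ltnP i (size s).+1; last by rewrite nth_default.
case: i lt => //= i lt; have /(allP ys) /= := mem_nth 0 (lt : i < size s).
lia.
Qed.

Lemma nth_conj la j : is_partition la ->
  nth 0 (conj_part la) j = count (fun z => j < z) la.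
Proof.
move=> pl; have [lt|ge] := ltnP j (head 0 la).
  by rewrite /conj_part nth_mkseq.
rewrite nth_default ?size_mkseq //; apply/esym/eqP.
by rewrite -leqn0 leqNgt -nth_count_gt // nth0; lia.
Qed.

Lemma conj_partition la : is_partition la -> is_partition (conj_part la).
Proof.
move=> pl; apply/partitionP; split=> i.
  by rewrite !nth_conj //; apply: sub_count => z /=; lia.
by rewrite size_mkseq nth_conj // -nth_count_gt // nth0.
Qed.

Lemma mem_conj la x y : is_partition la ->
  ((x, y) \in boxes (conj_part la)) = ((y, x) \in boxes la).
Proof.
move=> pl; rewrite !mem_boxes nth_conj //; case: x y => [|x] [|y] //=.
by rewrite -nth_count_gt.
Qed.

Lemma conj_partK la : is_partition la -> conj_part (conj_part la) = la.
Proof.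
move=> pl; have pc := conj_partition pl.
by apply: partition_eq => // [|x y]; rewrite ?conj_partition // !mem_conj.
Qed.

Lemma part_union_nil la : is_partition la -> part_union la [::] = la.
Proof.
move=> /andP[so _]; rewrite /part_union cats0.
by apply: sorted_sort => // ? ? ? /= h1 h2; exact: leq_trans h2 h1.
Qed.

(** The part [x] occupies the rows [p1 + 1] to [p2]. Comparing the box [(p2, x)] with the point
    [(p1 + 1, x + 1)] outside, [b] equal parts would give [(b - a) * (b - 1) < a]. *)
Lemma tri_left_count a b la x : 0 < a < b -> is_partition la ->
  tri_left a b (mem (boxes la)) -> 0 < x -> count_mem x la < b.
Proof.
move=> /andP[a0 ab] pl tri x0; rewrite ltnNge; apply/negP => le.
pose p1 := count (fun z => x < z) la; pose p2 := count (fun z => x.-1 < z) la.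
have p12 : p2 = p1 + count_mem x la.
  rewrite /p1 /p2 addnC -count_predUI.
  rewrite [count (predI _ _) _](_ : _ = 0) ?addn0; last first.
    by apply/eqP; rewrite -leqn0 leqNgt -has_count; apply/hasPn => z _ /=; lia.
  by apply: eq_count => z /=; lia.
have D1 : (p2, x) \in boxes la.
  rewrite mem_boxes; have := nth_count_gt x.-1 p2.-1 pl; rewrite -/p2; lia.
have D2 : (p1.+1, x.+1) \notin boxes la.
  by rewrite mem_boxes /=; have := nth_count_gt x p1 pl; rewrite -/p1; lia.
have [|[_ +]] := tri _ _ _ _ D1 (ltn0Sn _) (ltn0Sn _) D2; last lia.
by rewrite /ladder_index /=; nia.
Qed.

(** By [tri_left_count] the repeated part [ka] is empty, so the extended map is the Mullineux
    transpose; [mullineux_run] is applied with [Z] the profile of the column regularization. *)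
Lemma ext_mullineux_cross (a b : nat) la mu : 0 < a < b -> coprime a b ->
  is_partition la -> tri_left a b (mem (boxes la)) ->
  ext_mullineux_tr b la mu ->
  [/\ is_partition mu, diagram mu = column_reg a b (diagram la)
    & size (boxes mu) = size (boxes la)].
Proof.
move=> abP cop pl tri [nu [ka [nuT [/and3P[pn pk _] laE run ->]]]].
have ka0 : ka = [::].
  case: ka pk laE {run} => // x ka /andP[_ x0] laE.
  have := @tri_left_count a b la x abP pl tri; rewrite lt0n.
  have -> : x != 0 by apply: contraNneq x0 => ->; rewrite inE eqxx.
  move=> /(_ isT); rewrite laE count_sort count_cat /= count_cat.
  have -> : count_mem x (nseq b x) = b by rewrite count_nseq /= eqxx mul1n.
  lia.
rewrite {}ka0 in laE *; rewrite part_union_nil // in laE.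
subst nu.
have dl := partition_downset pl; have bl := partition_bounded pl.
have rX := profile_represents dl bl.
move: (profile _ _) rX => X rX.
have pD := @diagram_positive la.
have triD : tri_left a b (mem (diagram la)).
  by move=> x y x' y' /=; rewrite !mem_diagram; apply: tri.
set E := column_reg a b (diagram la).
have pE := column_reg_positive abP (D := diagram la).
have triE := column_reg_tri abP triD.
have dE := tri_right_downset abP pE triE.
have [M bE] := bounded_fset E.
pose N := (size la + head 0 la + M)%N.
have bl' : bounded N (mem (boxes la)) by move=> x y /bl; rewrite /N; lia.
have bE' : bounded N (mem E) by move=> x y /bE; rewrite /N; lia.
have rZ := profile_represents dE bE'.
move: (profile _ _) rZ => Z rZ.
have [a0 ab] := andP abP.
have admX := tri_left_admissible abP dl rX tri.
have admZ : admissible (b%:Z - a%:Z)%R b (tr Z).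
  rewrite subzn ?(ltnW ab) //; apply: (@tri_left_admissible _ _ (tr_set (mem E))).
  - lia.
  - exact/downset_tr.
  - exact: represents_tr.
  - by apply: tri_right_tr => //; lia.
have mXZ : matched a b N X Z.
  apply: (matched_count abP _ pE bl' bE' rX rZ) => [x y|c].
    by rewrite /= -mem_diagram; apply: pD.
  rewrite count_column_reg //; apply: eq_count => P /=.
  by rewrite mem_diagram.
have [pT rT szT] := mullineux_run a0 ab cop run pl rX admX admZ
  (represents_supported dl bl' rX) (represents_supported dE bE' rZ) mXZ.
have -> : conj_part (part_union (conj_part nuT) (part_star b (conj_part [::]))) = nuT.
  by rewrite part_union_nil ?conj_partition // conj_partK.
split=> //; apply/fsetP => -[x y]; rewrite mem_diagram.
have [x0|x0] := posnP x; first by rewrite mem_boxes x0; apply/esym/negP => /pE; lia.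
have [y0|y0] := posnP y.
  by rewrite mem_boxes y0 andbF; apply/esym/negP => /pE; lia.
by have /= -> := repr_mem rT x0 y0; have /= -> := repr_mem rZ x0 y0.
Qed.

(** * Moving between consecutive walls *)

Lemma mem_boxes_col la x y : is_partition la -> ((x, y) \in boxes la) =
  [&& 0 < x, 0 < y & x <= nth 0 (conj_part la) y.-1].
Proof. by move=> pl; rewrite -mem_conj // mem_boxes andbCA. Qed.

Lemma hook_le_size la x y x' y' : is_partition la ->
  (x, y) \in boxes la -> (x', y') \in boxes la -> x <= x' -> y' <= y ->
  (y - y') + (x' - x) < size (boxes la).
Proof.
move=> pl P Q xx yy; have [_ dn] := partition_downset pl.
have pP := proj1 (partition_downset pl) _ _ P.
have pQ := proj1 (partition_downset pl) _ _ Q.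
pose s := [seq (x, j) | j <- iota y' (y - y').+1] ++
          [seq (i, y') | i <- iota x.+1 (x' - x)].
have <- : size s = ((y - y') + (x' - x)).+1.
  by rewrite size_cat !size_map !size_iota.
apply: uniq_leq_size.
  rewrite cat_uniq !map_inj_uniq ?iota_uniq; try by move=> ? ? [].
  rewrite andbT; apply/hasPn => B /mapP[i + ->]; rewrite mem_iota => iP.
  by apply/mapP => -[j _ [iE _]]; lia.
move=> B; rewrite mem_cat => /orP[] /mapP[k + ->]; rewrite mem_iota => kP.
  by apply: (dn x y) P; lia.
by apply: (dn x' y') Q; lia.
Qed.

Lemma tri_right_left (a1 b1 a2 b2 n : nat) la : a1 < b1 -> 0 < a2 < b2 ->
  a1 * b2 < a2 * b1 -> is_partition la -> size (boxes la) = n ->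
  (forall p q, 0 < q <= n -> p <= q -> a1 * q < p * b1 -> a2 * q <= p * b2) ->
  tri_right a1 b1 (mem (boxes la)) -> tri_left a2 b2 (mem (boxes la)).
Proof.
move=> ab1 /andP[a20 ab2] lt12 pl sz gap tri x y x' y' P x0 y0 Q.
have form a b u v : a <= b ->
    (ladder_index a b (u, v))%:Z = (b%:Z * u%:Z + a%:Z * (v%:Z - u%:Z))%R.
  by move=> ab; rewrite /ladder_index PoszD !PoszM -subzn //=; lia.
pose d (a b x y x' y' : nat) : int :=
  (b%:Z * (x%:Z - x'%:Z) + a%:Z * (y%:Z - x%:Z - (y'%:Z - x'%:Z)))%R.
have key u v : 0 < u -> 0 < v -> (u, v) \notin boxes la ->
    (0 < d a2 b2 x y u v \/
     d a2 b2 x y u v = 0 /\ y%:Z - x%:Z - (v%:Z - u%:Z) <= 0)%R ->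
    [/\ (0 < y%:Z - x%:Z - (v%:Z - u%:Z))%R, (d a1 b1 x y u v < 0)%R
      & (0 < d a2 b2 x y u v)%R].
  move=> u0 v0 nuv.
  have := tri _ _ _ _ P u0 v0 nuv.
  have := form a1 b1 x y (ltnW ab1); have := form a1 b1 u v (ltnW ab1).
  rewrite /d; set U := (x%:Z - u%:Z)%R; set K := (y%:Z - x%:Z - (v%:Z - u%:Z))%R.
  move=> f1 f2 t1.
  have d1 : (b1%:Z * U + a1%:Z * K < 0 \/ b1%:Z * U + a1%:Z * K = 0 /\ K < 0)%R.
    by rewrite /U /K; case: t1 => [t1|[t1 t1']]; [left|right]; lia.
  clear f1 f2 t1; clearbody U K.
  have lt12' : (0 < a2%:Z * b1%:Z - a1%:Z * b2%:Z)%R by lia.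
  have [K0|K0] : (0 < K \/ K <= 0)%R by lia.
    by case=> [|[_]]; [split=> //; lia|lia].
  move=> d2; exfalso.
  set e1 := (b1%:Z * U + a1%:Z * K)%R in d1; set e2 := (b2%:Z * U + a2%:Z * K)%R in d2.
  (* This combination eliminates [U]: when the slope grows, only pairs whose inner point has the
     larger content ([K > 0]) can change order. *)
  have id : (b2%:Z * e1 - b1%:Z * e2 = - K * (a2%:Z * b1%:Z - a1%:Z * b2%:Z))%R.
    by rewrite /e1 /e2; lia.
  have p1 : (b2%:Z * e1 <= 0)%R by rewrite pmulr_rle0; lia.
  have p2 : (0 <= b1%:Z * e2)%R by rewrite pmulr_rge0; lia.
  have [K1|K1] : (K < 0 \/ K = 0)%R by lia.
    have : (0 < - K * (a2%:Z * b1%:Z - a1%:Z * b2%:Z))%R by apply: mulr_gt0; lia.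
    lia.
  have : (b2%:Z * e1 < 0)%R by rewrite pmulr_rlt0; lia.
  by rewrite K1 oppr0 mul0r in id; lia.
have [lt|ge] := ltnP (ladder_index a2 b2 (x, y)) (ladder_index a2 b2 (x', y')).
  by left.
have f1 := form a2 b2 x y (ltnW ab2); have f2 := form a2 b2 x' y' (ltnW ab2).
have [E|ne] := eqVneq (ladder_index a2 b2 (x, y)) (ladder_index a2 b2 (x', y')).
  right; split=> //; rewrite ltnNge; apply/negP => le.
  have [] := key x' y' x0 y0 Q; rewrite /d; lia.
exfalso.
have [K0 D1 D2] : [/\ (0 < y%:Z - x%:Z - (y'%:Z - x'%:Z))%R,
    (d a1 b1 x y x' y' < 0)%R & (0 < d a2 b2 x y x' y')%R].
  by apply: key => //; left; rewrite /d; lia.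
have xx : x < x' by rewrite /d in D1; nia.
have yy : y' < y by rewrite /d in D2; nia.
have [pos dn] := partition_downset pl.
have [px py] := pos _ _ P.
have Dxy' : (x, y') \in boxes la by apply: (dn x y) P; lia.
(* The outer point is raised to just below column [y']. It stays outside and its index decreases by
   [b2 - a2] per row, so the reversal at the second wall persists, and [key] restores it at the
   first. *)
pose h := nth 0 (conj_part la) y'.-1.
have hx : x <= h by move: Dxy'; rewrite mem_boxes_col // => /and3P[].
have hx' : h < x' by move: Q; rewrite /= mem_boxes_col // x0 y0 /= -ltnNge.
have Dh : (h, y') \in boxes la by rewrite mem_boxes_col // leqnn y0; lia.
have Nh : (h.+1, y') \notin boxes la by rewrite mem_boxes_col //= -/h ltnn !andbF.
have [|K1 D3 D4] := @key h.+1 y' isT y0 Nh.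
  left; apply: lt_le_trans D2 _; rewrite -subr_ge0 /d.
  have : (0 <= (b2%:Z - a2%:Z) * (x'%:Z - h.+1%:Z))%R by apply: mulr_ge0; lia.
  lia.
have := hook_le_size pl P Dh hx (ltnW yy); rewrite sz => hn.
(* [q] counts the boxes of the hook path from [(x, y)] through the corner [(x, y')] to [(h, y')],
   hence is at most [n]; the reversal says that [p/q] lies strictly between the two walls. *)
pose p := h.+1 - x; pose q := y - y' + p.
have pE : p%:Z = (h.+1%:Z - x%:Z)%R by rewrite /p; lia.
have qE : q%:Z = (y%:Z - x%:Z - (y'%:Z - h.+1%:Z))%R by rewrite /q; lia.
have d1 : (d a1 b1 x y h.+1 y' = a1%:Z * q%:Z - p%:Z * b1%:Z)%R.
  by rewrite /d qE pE; lia.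
have d2 : (d a2 b2 x y h.+1 y' = a2%:Z * q%:Z - p%:Z * b2%:Z)%R.
  by rewrite /d qE pE; lia.
have := gap p q; rewrite d1 in D3; rewrite d2 in D4.
have : 0 < q <= n by rewrite /q /p; lia.
have : p <= q by rewrite /q; lia.
lia.
Qed.

(** * Hook ratios on the two sides of a wall *)

Lemma ratio_le (p q a b : nat) : 0 < q -> 0 < b ->
  (p%:R / q%:R <= a%:R / b%:R :> rat)%R = (p * b <= a * q).
Proof.
move=> q0 b0; rewrite ler_pdivrMr ?ltr0n // mulrAC ler_pdivlMr ?ltr0n //.
by rewrite -!natrM ler_nat.
Qed.

Lemma ratio_lt (p q a b : nat) : 0 < q -> 0 < b ->
  (p%:R / q%:R < a%:R / b%:R :> rat)%R = (p * b < a * q).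
Proof. by move=> q0 b0; rewrite ltNge ratio_le // ltnNge. Qed.

Lemma ratio_eq (p q a b : nat) : 0 < q -> 0 < b -> p * b = a * q ->
  (p%:R / q%:R = a%:R / b%:R :> rat)%R.
Proof. by move=> q0 b0 E; apply/eqP; rewrite eq_le !ratio_le // E leqnn. Qed.

Lemma box_arm_leg la x y : is_partition la -> (x, y) \in boxes la ->
  nth 0 la x.-1 = y + arm la (x, y) /\
  nth 0 (conj_part la) y.-1 = x + leg la (x, y).
Proof.
move=> pl B; rewrite /arm /leg /=.
have := B; rewrite mem_boxes_col // => /and3P[_ _ h1].
by move: B; rewrite mem_boxes => /and3P[_ _ h2]; lia.
Qed.

Lemma leg1_ratio_ge (a b : nat) la r : 0 < a < b -> is_partition la ->
  tri_left a b (mem (boxes la)) -> r \in leg1_ratios la ->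
  (a%:R / b%:R <= r)%R.
Proof.
move=> /andP[a0 ab] pl tri /mapP[[x y] B ->].
have [e1 e2] := box_arm_leg pl B.
have /andP[x0 y0] : (0 < x) && (0 < y).
  by move: (B); rewrite mem_boxes => /and3P[-> ->].
have P : (x, y + arm la (x, y)) \in boxes la by rewrite mem_boxes e1; lia.
have Q : ((x + leg la (x, y)).+1, y) \notin boxes la.
  by rewrite mem_boxes_col // -e2 ltnn !andbF.
have le : ladder_index a b (x, y + arm la (x, y)) <=
          ladder_index a b ((x + leg la (x, y)).+1, y).
  by have [/ltnW//|[-> _]] := tri _ _ _ _ P (ltn0Sn _) y0 Q.
rewrite ratio_le; [|lia|by rewrite /hook addn1].
by move: le; rewrite /ladder_index /hook /=; nia.
Qed.

(** Comparing the foot of the leg with the point just beyond the arm gives [b l <= a H]. *)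
Lemma leg_ratio_le (a b : nat) la r : 0 < a < b -> is_partition la ->
  tri_right a b (mem (boxes la)) -> r \in leg_ratios la ->
  (r <= a%:R / b%:R)%R.
Proof.
move=> /andP[a0 ab] pl tri /mapP[[x y] B ->].
have [e1 e2] := box_arm_leg pl B.
have /andP[x0 y0] : (0 < x) && (0 < y).
  by move: (B); rewrite mem_boxes => /and3P[-> ->].
have P : (x + leg la (x, y), y) \in boxes la by rewrite mem_boxes_col // e2; lia.
have Q : (x, (y + arm la (x, y)).+1) \notin boxes la.
  by rewrite mem_boxes -e1 ltnn !andbF.
have le : ladder_index a b (x + leg la (x, y), y) <=
          ladder_index a b (x, (y + arm la (x, y)).+1).
  by have [/ltnW//|[-> _]] := tri _ _ _ _ P x0 (ltn0Sn _) Q.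
rewrite ratio_le; [|by rewrite /hook addn1|lia].
by move: le; rewrite /ladder_index /hook /=; nia.
Qed.

Definition partial_ladder (a b : nat) (D : pred box) : Prop :=
  exists x y x' y', [/\ D (x, y), 0 < x', 0 < y', ~~ D (x', y')
    & ladder_index a b (x, y) = ladder_index a b (x', y')].

(** On a partially filled ladder, triangularity makes an inner point the end of its row and an outer
    point the first one below its column; the box where that row and column cross has ratio exactly
    [a/b]. *)
Lemma leg1_ratio_attained (a b : nat) la : 0 < a < b -> is_partition la ->
  tri_left a b (mem (boxes la)) -> partial_ladder a b (mem (boxes la)) ->
  (a%:R / b%:R)%R \in leg1_ratios la.
Proof.
move=> abP pl tri [x [y [x' [y' [P x0' y0' Q E]]]]].
have [a0 ab] := andP abP.
have [pos dn] := partition_downset pl; have [x0 y0] := pos _ _ P.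
have [|[_ lt]] := tri _ _ _ _ P x0' y0' Q; first by rewrite E ltnn.
have [xx yy] : x < x' /\ y' < y by move: E; rewrite /ladder_index /=; nia.
have P1 : (x, y.+1) \notin boxes la.
  apply/negP => P1; have := tri _ _ _ _ P1 x0' y0' Q.
  by move: E; rewrite /ladder_index /=; lia.
have Q1 : (x'.-1, y') \in boxes la.
  apply/negPn/negP => Q1; have x1 : 0 < x'.-1 by lia.
  have := tri _ _ _ _ P x1 y0' Q1.
  by move: E; rewrite /ladder_index /=; nia.
have B : (x, y') \in boxes la by apply: (dn x y) P; lia.
have [e1 e2] := box_arm_leg pl B.
have ny : nth 0 la x.-1 = y.
  by move: P P1; rewrite /= !mem_boxes x0 y0 /=; lia.
have cx : nth 0 (conj_part la) y'.-1 = x'.-1.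
  by move: Q Q1; rewrite /= !mem_boxes_col // x0' y0' /=; lia.
apply/mapP; exists (x, y') => //; apply: ratio_eq; rewrite /hook ?addn1 //; first lia.
move: (arm _ _) (leg _ _) e1 e2 E => A L; rewrite ny cx => -> e2.
have -> : x' = (x + L).+1 by lia.
by rewrite /ladder_index /=; nia.
Qed.

(** With rows and columns exchanged: the inner point is the foot of its column, the outer one
    follows the end of its row. *)
Lemma leg_ratio_attained (a b : nat) la : 0 < a < b -> is_partition la ->
  tri_right a b (mem (boxes la)) -> partial_ladder a b (mem (boxes la)) ->
  (a%:R / b%:R)%R \in leg_ratios la.
Proof.
move=> abP pl tri [x [y [x' [y' [P x0' y0' Q E]]]]].
have [a0 ab] := andP abP.
have [pos dn] := partition_downset pl; have [x0 y0] := pos _ _ P.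
have [|[_ lt]] := tri _ _ _ _ P x0' y0' Q; first by rewrite E ltnn.
have [xx yy] : x' < x /\ y < y' by move: E; rewrite /ladder_index /=; nia.
have P1 : (x.+1, y) \notin boxes la.
  apply/negP => P1; have := tri _ _ _ _ P1 x0' y0' Q.
  by move: E; rewrite /ladder_index /=; nia.
have Q1 : (x', y'.-1) \in boxes la.
  apply/negPn/negP => Q1; have y1 : 0 < y'.-1 by lia.
  have := tri _ _ _ _ P x0' y1 Q1.
  by move: E; rewrite /ladder_index /=; nia.
have B : (x', y) \in boxes la by apply: (dn x y) P; lia.
have [e1 e2] := box_arm_leg pl B.
have ny : nth 0 la x'.-1 = y'.-1.
  by move: Q Q1; rewrite /= !mem_boxes x0' y0' /=; lia.
have cx : nth 0 (conj_part la) y.-1 = x.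
  by move: P P1; rewrite /= !mem_boxes_col // x0 y0 /=; lia.
apply/mapP; exists (x', y) => //; apply: ratio_eq; rewrite /hook ?addn1 //; first lia.
move: (arm _ _) (leg _ _) e1 e2 E => A L; rewrite ny cx => e1 ->.
have -> : y' = (y + A).+1 by lia.
by rewrite /ladder_index /=; nia.
Qed.

Lemma partial_ladder_count (a b : nat) (D : pred box) c : 0 < a < b ->
  0 < count D (ladder a b c) < size (ladder a b c) -> partial_ladder a b D.
Proof.
move=> abP /andP[]; rewrite -has_count => /hasP[[x y] PL P] lt.
have [[x' y'] QL Q] : exists2 Q, Q \in ladder a b c & ~~ D Q.
  by apply/hasP; rewrite has_predC all_count neq_ltn lt.
move: PL QL; rewrite !mem_ladder // => /and3P[_ _ /eqP e1] /and3P[x0 y0 /eqP e2].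
by exists x, y, x', y'; rewrite e1 e2.
Qed.

(** Empty and full ladders are reproduced unchanged. *)
Lemma column_reg_changed (a b : nat) (D : {fset box}) : 0 < a < b ->
  positive (mem D) -> column_reg a b D != D ->
  exists c, 0 < count (mem D) (ladder a b c) < size (ladder a b c).
Proof.
move=> abP pD ne; suff [P PP] : exists P, (P \in column_reg a b D) != (P \in D).
  exists (ladder_index a b P); move: PP; rewrite mem_column_reg //.
  set c := ladder_index a b P; rewrite lt0n ltn_neqAle count_size andbT => PP.
  apply/andP; split; apply: contraNneq PP => k0.
    rewrite k0 take0 in_nil eq_sym; apply/eqP/negP => PD.
    have : has (mem D) (ladder a b c); last by rewrite has_count k0.
    apply/hasP; exists P => //; rewrite /c; case: (P) PD => x y /pD[x0 y0].
    by rewrite mem_ladder // x0 y0 eqxx.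
  rewrite k0 take_size; have /allP al : all (mem D) (ladder a b c).
    by rewrite all_count k0.
  apply/eqP; apply/idP/idP => [/al//|]; rewrite /c; case: (P) => x y /pD[x0 y0].
  by rewrite mem_ladder // x0 y0 eqxx.
have [/hasP[P _ PP]|/hasPn al] := boolP (has
    (fun P => (P \in column_reg a b D) != (P \in D)) (column_reg a b D `|` D)%fset).
  by exists P.
case/eqP: ne; apply/fsetP => P.
have [PU|] := boolP (P \in (column_reg a b D `|` D)%fset).
  by have := al P PU; rewrite negbK => /eqP.
by rewrite in_fsetU negb_or => /andP[/negPf -> /negPf ->].
Qed.

(** * Farey sequences *)

Lemma farey_bounds n w : w \in farey n -> (0 <= w <= 1)%R.
Proof.
rewrite mem_sort => /allpairsPdep[q [p [qn + ->]]].
move: qn; rewrite mem_filter !mem_iota => qn /andP[_ pq].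
have -> : (0 = 0%:R / 1%:R :> rat)%R by rewrite mul0r.
have -> : (1 = 1%:R / 1%:R :> rat)%R by rewrite divr1.
by rewrite !ratio_le; lia.
Qed.

Lemma mem_farey n (p q : nat) : 0 < q <= n -> p <= q ->
  (p%:R / q%:R)%R \in farey n.
Proof.
move=> /andP[q0 qn] pq; rewrite mem_sort; apply/allpairsPdep.
have g0 : 0 < gcdn p q by rewrite gcdn_gt0 q0 orbT.
exists (q %/ gcdn p q), (p %/ gcdn p q).
have q0' : 0 < q %/ gcdn p q by rewrite divn_gt0 // dvdn_leq // dvdn_gcdr.
split.
- by rewrite mem_iota q0' add1n ltnS (leq_trans (leq_div _ _)).
- rewrite mem_filter mem_iota; apply/andP; split; last first.
    by rewrite add0n ltnS leq_div2r.
  rewrite /coprime -(eqn_pmul2r g0) mul1n muln_gcdl !divnK //.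
    exact: dvdn_gcdr.
  exact: dvdn_gcdl.
- apply: ratio_eq => //.
  by rewrite mulnC [RHS]mulnC -muln_divCA_gcd // mulnC.
Qed.

Lemma num_den_ratio (w : rat) : (0 <= w)%R ->
  (w = (absz (numq w))%:R / (absz (denq w))%:R)%R.
Proof.
move=> w0; rewrite -{1}(divq_num_den w).
have -> : (numq w)%:~R = (absz (numq w))%:R :> rat.
  by rewrite -[in LHS](@gez0_abs (numq w)) ?numq_ge0.
by rewrite -[in LHS](@gez0_abs (denq w)) // ltW ?denq_gt0.
Qed.

Section Farey.

Variable n : nat.

Local Notation F := (farey n).
Local Notation w i := (nth 0%R F i).
Local Notation a i := (absz (numq (w i))).
Local Notation b i := (absz (denq (w i))).

Lemma farey_lt i j : i < size F -> j < size F -> (w i < w j)%R = (i < j).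
Proof. by move=> iF jF; apply: (lt_sorted_ltn_nth 0%R (farey_sorted n)). Qed.

Lemma farey_ratio i : i < size F -> w i = ((a i)%:R / (b i)%:R)%R.
Proof.
by move=> iF; apply: num_den_ratio; have /andP[] := farey_bounds (mem_nth 0%R iF).
Qed.

Lemma farey_den_gt0 i : 0 < b i.
Proof. by rewrite absz_gt0 denq_neq0. Qed.

Lemma farey_lt1 i : i.+1 < size F -> a i < b i.
Proof.
move=> iF; have b0 := farey_den_gt0 i.
have : (w i < 1)%R.
  apply: lt_le_trans (_ : w i.+1 <= 1)%R; first by rewrite farey_lt // ltnW.
  by have /andP[] := farey_bounds (mem_nth 0%R iF).
rewrite {1}(farey_ratio (ltnW iF)).
have -> : (1 = 1%:R / 1%:R :> rat)%R by rewrite divr1.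
by rewrite ratio_lt //; lia.
Qed.

Lemma farey_consecutive i : i.+1 < size F ->
  a i * b i.+1 < a i.+1 * b i /\
  (forall p q, 0 < q <= n -> p <= q -> a i * q < p * b i ->
     a i.+1 * q <= p * b i.+1).
Proof.
move=> iF; have b0 := farey_den_gt0 i; have b1 := farey_den_gt0 i.+1.
have e0 := farey_ratio (ltnW iF); have e1 := farey_ratio iF.
split; first by rewrite -ratio_lt // -e0 -e1 farey_lt // ltnW.
move=> p q qP pq lt; have q0 : 0 < q by case/andP: qP.
have pF := mem_farey qP pq; set v := (p%:R / q%:R)%R in pF.
have kF : index v F < size F by rewrite index_mem.
have kE : w (index v F) = v by apply: nth_index.
rewrite leqNgt; apply/negP => lt'.
have l1 : i < index v F by rewrite -(farey_lt (ltnW iF) kF) kE e0 ratio_lt.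
have l2 : index v F < i.+1 by rewrite -(farey_lt kF iF) kE e1 ratio_lt.
lia.
Qed.

Lemma farey_wall i : 0 < n -> i.+2 < size F ->
  0 < a i.+1 < b i.+1 /\ coprime (a i.+1) (b i.+1).
Proof.
move=> n_gt0 iF; split; last exact: coprime_num_den.
rewrite farey_lt1 // andbT absz_gt0 numq_eq0.
have : (w 0 < w i.+1)%R by rewrite farey_lt //; lia.
by rewrite farey_nth0 // => /lt0r_neq0.
Qed.

End Farey.

(** The start of the induction: for the fraction 0/1 the ladder index is the row number, and ties
    are broken from the left. *)
Lemma tri_right_row n : tri_right 0 1 (mem (boxes [:: n])).
Proof.
move=> x y x' y' /=; rewrite !mem_boxes /ladder_index /=.
case: x => [|[|x]] //=; last by rewrite nth_nil; lia.
case: x' => [|[|x']] //= /andP[y0 yn] _ y0'; rewrite ?nth_nil; lia.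
Qed.

(** * Induction along the Farey sequence, and its breaks *)

Section WallCrossing.

Variables (n : nat) (lam : nat -> seq nat) (tlam : nat -> {fset box}).
Hypotheses (n_gt0 : 0 < n) (lamP : mullineux_seq n lam)
  (tlamP : column_reg_seq n tlam).

Local Notation F := (farey n).
Local Notation w i := (nth 0%R F i).
Local Notation a i := (absz (numq (w i))).
Local Notation b i := (absz (denq (w i))).

Lemma diagram_inj la mu : is_partition la -> is_partition mu ->
  diagram la = diagram mu -> la = mu.
Proof.
move=> pl pm E; apply: partition_eq => // x y.
by rewrite -!mem_diagram E.
Qed.

(** Triangularity is recorded at the left end of the interval; [tri_right_left] transports it to the
    right end, where the wall is crossed. *)
Lemma wall_state i : i.+1 < size F ->
  [/\ is_partition (lam i), size (boxes (lam i)) = n, tlam i = diagram (lam i)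
    & tri_right (a i) (b i) (mem (boxes (lam i)))].
Proof.
have [lam0 lamS] := lamP; have [tlam0 tlamS] := tlamP.
elim: i => [|i IH] iF.
  rewrite lam0 tlam0 farey_nth0 //; split=> //.
  - by apply/andP; rewrite inE; split=> //; lia.
  - by rewrite size_allpairs_dep /= size_iota addn0.
  - exact: tri_right_row.
have [pl sz tE tri] := IH (ltnW iF).
have [abP cop] := farey_wall n_gt0 iF.
have [lt gap] := farey_consecutive (ltnW iF).
have triL := tri_right_left (farey_lt1 (ltnW iF)) abP lt pl sz gap tri.
have [pm dE sz'] := ext_mullineux_cross abP cop pl triL (lamS i iF).
split=> //; first by rewrite sz'.
  by rewrite tlamS // tE dE.
move=> x y x' y' /=; rewrite -!mem_diagram dE.
apply: (column_reg_tri abP) => {x y x' y'} x y x' y' /=.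
by rewrite !mem_diagram; apply: triL.
Qed.

Lemma wall_left i : i.+2 < size F ->
  tri_left (a i.+1) (b i.+1) (mem (boxes (lam i))).
Proof.
move=> iF; have [pl sz _ tri] := wall_state (ltnW iF).
have [abP _] := farey_wall n_gt0 iF.
have [lt gap] := farey_consecutive (ltnW iF).
exact: tri_right_left (farey_lt1 (ltnW iF)) abP lt pl sz gap tri.
Qed.

(** Column regularization preserves the ladder counts, so one ladder is partial on both sides of the
    wall. *)
Lemma wall_partial i : i.+2 < size F -> lam i != lam i.+1 ->
  partial_ladder (a i.+1) (b i.+1) (mem (boxes (lam i))) /\
  partial_ladder (a i.+1) (b i.+1) (mem (boxes (lam i.+1))).
Proof.
move=> iF ne; have [pl _ tE _] := wall_state (ltnW iF).
have [pm _ tE' _] := wall_state iF; have [abP _] := farey_wall n_gt0 iF.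
have dE : diagram (lam i.+1) =
    column_reg (a i.+1) (b i.+1) (diagram (lam i)).
  by rewrite -tE' -tE; apply: (proj2 tlamP).
have [|c cP] := column_reg_changed abP (@diagram_positive (lam i)).
  by rewrite -dE eq_sym; apply: contraNneq ne => /(diagram_inj pl pm) ->.
have cE la : count (mem (boxes la)) =1 count (mem (diagram la)).
  by apply: eq_count => P /=; rewrite mem_diagram.
split; apply: (partial_ladder_count (c := c) abP); rewrite cE //.
by rewrite dE count_column_reg.
Qed.

Lemma breaks_eq : breaks n lam = breaks n tlam.
Proof.
congr cons; congr map; apply: eq_in_filter => i.
rewrite mem_iota => /andP[_ iP]; have iF : i.+2 < size F by lia.
have [pl _ -> _] := wall_state (ltnW iF); have [pm _ -> _] := wall_state iF.
by congr negb; apply/eqP/eqP => [->//|]; apply: diagram_inj.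
Qed.

Lemma size_farey : 1 < size F.
Proof.
have F0 : (0%R : rat) \in F.
  by have := @mem_farey n 0 1; rewrite mul0r; apply; lia.
have F1 : (1%R : rat) \in F.
  by have := @mem_farey n 1 1; rewrite divr1; apply; lia.
case E: F F0 F1 => [|u [|v s]] //; rewrite !inE => /eqP <- /eqP.
by move/eqP; rewrite oner_eq0.
Qed.

Lemma break_index (T : eqType) (f : nat -> T) k : k < size (breaks n f) ->
  exists j, [/\ j.+1 < size F, nth 0%R (breaks n f) k = w j,
    index (nth 0%R (breaks n f) k) F = j
    & 0 < k -> exists2 i, j = i.+1 & f i != f i.+1].
Proof.
have uF : uniq F by apply: (sorted_uniq lt_trans ltxx); apply: farey_sorted.
have sF := size_farey.
case: k => [|k] kP.
  exists 0; split=> //=; first by rewrite farey_nth0.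
  by rewrite -{1}(farey_nth0 n_gt0) index_uniq // ltnW.
rewrite /= size_map in kP.
have := mem_nth 0 kP; rewrite /= (nth_map 0) //; set i := nth _ _ k.
rewrite mem_filter mem_iota => /andP[ne /andP[_ iP]].
have iF : i.+2 < size F by move: iP; lia.
exists i.+1; split=> //; last by exists i.
by rewrite index_uniq // ltnW.
Qed.

(** [piece] evaluates at the interval starting at the break [k - 1], whereas the minimum is taken at
    the interval ending at the break [k]. *)
Lemma piece_left k i : 0 < k < size (breaks n lam) -> i.+2 < size F ->
  nth 0%R (breaks n lam) k = w i.+1 -> piece n lam k = lam i.
Proof.
move=> /andP[k0 kP] iF kE; apply/esym/pieceE => //; rewrite ?k0 ?(ltnW kP) //.
- exact: ltnW.
- have kP' : k.-1 < size (breaks n lam) by lia.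
  have [j [jF jE _ _]] := break_index kP'.
  rewrite (set_nth_default 0%R) // jE.
  have : (nth 0%R (breaks n lam) k.-1 < nth 0%R (breaks n lam) k)%R.
    by rewrite (lt_sorted_ltn_nth 0%R (breaks_sorted lam n_gt0)) ?unfold_in //; lia.
  rewrite jE kE farey_lt; [|lia|lia] => ji.
  have [jF' iF'] : j < size F /\ i < size F by lia.
  by rewrite (lt_sorted_leq_nth 0%R (farey_sorted n)) ?unfold_in.
- by rewrite (set_nth_default 0%R) // kE.
Qed.

End WallCrossing.

Theorem theorem3p5 (n : nat) (lam : nat -> seq nat)
    (tlam : nat -> {fset box})
    (n_gt0 : 0 < n)
    (lamP : mullineux_seq n lam) (tlamP : column_reg_seq n tlam) :
  let p := breaks n lam in
  let q := breaks n tlam in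
  [/\ size p = size q,
      forall k : nat, 0 < k < size p ->
        [/\ nth 0%R p k = nth 0%R q k,
            is_min (nth 0%R p k) (leg1_ratios (piece n lam k))
          & is_max (nth 0%R p k) (leg_ratios (piece n lam k.+1))]
    & forall k : nat, 0 < k <= size p ->
        diagram (piece n lam k) = piece n tlam k].
Proof.
move=> p q; have pq : p = q := breaks_eq n_gt0 lamP tlamP.
split=> [|k /andP[k0 kP]|k /andP[k0 kP]]; first by rewrite pq.
- have [j [jF jE jI /(_ k0)[i jEi ne]]] := break_index n_gt0 kP.
  rewrite {}jEi in jF jE jI; have [abP _] := farey_wall n_gt0 jF.
  have [pl _ _ _] := wall_state n_gt0 lamP tlamP (ltnW jF).
  have [pm _ _ triR] := wall_state n_gt0 lamP tlamP jF.
  have triL := wall_left n_gt0 lamP tlamP jF.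
  have [partL partR] := wall_partial n_gt0 lamP tlamP jF ne.
  have kP' : 0 < k < size (breaks n lam) by rewrite k0.
  rewrite (piece_left n_gt0 kP' jF jE) /piece /= jI -pq -/p.
  rewrite [nth _ p k]jE (farey_ratio (ltnW jF)); split=> //; split.
  + exact: leg1_ratio_attained.
  + by move=> r; apply: leg1_ratio_ge.
  + exact: leg_ratio_attained.
  + by move=> r; apply: leg_ratio_le.
have kP' : k.-1 < size p by lia.
have [j [jF _ jI _]] := break_index n_gt0 kP'.
rewrite /piece -[breaks n tlam]pq jI.
by have [_ _ -> _] := wall_state n_gt0 lamP tlamP jF.
Qed.
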